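(* Let $G=\mathrm{SU}(2)\times\mathrm{SU}(2)$. Every left-invariant Einstein metric $g$ on $G$ is preserved by a nonidentity inner automorphism of $G$. Equivalently, for a left-invariant Riemannian metric $g$ on $G$, $$\mathrm{Ric}_g=\lambda g\ \text{ for some }\lambda\in\mathbb R\quad\Longrightarrow\quad K(g)\neq\{e\}.$$
   Context: A left-invariant metric on $G$ is a left-invariant Riemannian metric; it is Einstein when $\mathrm{Ric}_g=\lambda g$ for a constant $\lambda$. $\mathrm{Inn}(G)$ is the group of conjugations $x\mapsto axa^{-1}$, $a\in G$. The inner isotropy of $g$ is $K(g):=\mathrm{Isom}(G,g)\cap\mathrm{Inn}(G)$, and $\{e\}$ denotes the trivial group consisting of the identity map only. *)

(* Defs.v *)
From HB Require Import structures.
From mathcomp Require Import all_boot all_order all_algebra.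
From mathcomp Require Import all_classical all_reals all_analysis.
From mathcomp Require Import complex.

Set Implicit Arguments.
Unset Strict Implicit.
Unset Printing Implicit Defensive.
Import Order.TTheory GRing.Theory Num.Theory numFieldNormedType.Exports.
Local Open Scope classical_set_scope.
Local Open Scope ring_scope.
Local Open Scope complex_scope.
Local Open Scope sesquilinear_scope.

Section SpecialUnitary.
Variable R : realType.

Record SU2 := MkSU2 {
  SU2val :> 'M[R[i]]_2;
  SU2valP : (SU2val \is unitarymx) && (\det SU2val == 1) }.

HB.instance Definition _ := [isSub for SU2val].
HB.instance Definition _ := [Choice of SU2 by <:].

Fact SU2_one_subproof :
  ((1%:M : 'M[R[i]]_2) \is unitarymx) && (\det (1%:M : 'M[R[i]]_2) == 1).
Proof. by rewrite det1 eqxx andbT; apply/unitarymxP; rewrite trmx1 map_mx1 mulmx1. Qed.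

Fact SU2_mul_subproof (x y : SU2) :
  (SU2val x *m SU2val y \is unitarymx) && (\det (SU2val x *m SU2val y) == 1).
Proof.
case: x y => [x /andP[xU /eqP xd]] [y /andP[yU /eqP yd]] /=.
by rewrite mul_unitarymx //= det_mulmx xd yd mulr1.
Qed.

Fact SU2_inv_subproof (x : SU2) :
  (invmx (SU2val x) \is unitarymx) && (\det (invmx (SU2val x)) == 1).
Proof.
case: x => [x /andP[xU /eqP xd]] /=.
by rewrite invmx_unitary // trmxC_unitary xU /= -invmx_unitary // det_inv xd invr1.
Qed.

Definition SU2_one := MkSU2 SU2_one_subproof.
Definition SU2_mul x y := MkSU2 (SU2_mul_subproof x y).
Definition SU2_inv x := MkSU2 (SU2_inv_subproof x).

Fact SU2_unit (x : SU2) : SU2val x \in unitmx.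
Proof. by case: x => x /= /andP[xU _]; exact: unitarymx_unit. Qed.

Fact SU2_mulA : associative SU2_mul.
Proof. by move=> x y z; apply: val_inj; rewrite /= mulmxA. Qed.
Fact SU2_mul1 : left_id SU2_one SU2_mul.
Proof. by move=> x; apply: val_inj; rewrite /= mul1mx. Qed.
Fact SU2_1mul : right_id SU2_one SU2_mul.
Proof. by move=> x; apply: val_inj; rewrite /= mulmx1. Qed.
Fact SU2_mulV : left_inverse SU2_one SU2_inv SU2_mul.
Proof. by move=> x; apply: val_inj; rewrite /= mulVmx ?SU2_unit. Qed.
Fact SU2_Vmul : right_inverse SU2_one SU2_inv SU2_mul.
Proof. by move=> x; apply: val_inj; rewrite /= mulmxV ?SU2_unit. Qed.

HB.instance Definition _ :=
  isGroup.Build SU2 SU2_mulA SU2_mul1 SU2_1mul SU2_mulV SU2_Vmul.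

End SpecialUnitary.

(* SU(2) x SU(2) is treated as an embedded submanifold of the real vector    *)
(* space of pairs of complex 2 x 2 matrices.                                  *)
Section RiemannianGeometry.
Variable R : realType.
Local Notation G := (SU2 R * SU2 R)%type.
Local Notation V := ('M[R[i]]_2 * 'M[R[i]]_2)%type.

Definition embed (x : G) : V := (SU2val x.1, SU2val x.2).

(* The 16 real coordinates of V: which factor, real or imaginary part, and    *)
(* the matrix entry.                                                          *)
Definition rcoord_index := (bool * bool * 'I_2 * 'I_2)%type.

Definition rcoord (k : rcoord_index) (u : V) : R :=
  let: (fac, part, i, j) := k in
  let z := (if fac then u.1 else u.2) i j in
  if part then complex.Re z else complex.Im z.

Definition of_rcoord (c : rcoord_index -> R) : V :=
  (\matrix_(i, j) (c (true, true, i, j) +i* c (true, false, i, j)),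
   \matrix_(i, j) (c (false, true, i, j) +i* c (false, false, i, j))).

Definition velocity (gam : R -> G) (u : V) : Prop :=
  forall k, is_derive (0 : R) (1 : R) (fun t => rcoord k (embed (gam t))) (rcoord k u).

Definition tangent (x : G) (u : V) : Prop :=
  exists2 gam : R -> G, gam 0 = x & velocity gam u.

Definition is_dirderiv (f : G -> R) (x : G) (u : V) (w : R) : Prop :=
  forall gam : R -> G, gam 0 = x -> velocity gam u ->
    is_derive (0 : R) (1 : R) (f \o gam) w.

Definition differentiable_at (f : G -> R) (x : G) : Prop :=
  exists2 D : V -> R,
    forall (a : R) (u v : V), D (a%:C *: u + v) = a * D u + D v &
    forall u, tangent x u -> is_dirderiv f x u (D u).

(* df_x(u); meaningful when f is differentiable at x and u is tangent at x.   *)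
Definition dirderiv (f : G -> R) (x : G) (u : V) : R :=
  xget 0 [set w | is_dirderiv f x u w].

Definition left_field (A : V) (x : G) : V :=
  (SU2val x.1 *m A.1, SU2val x.2 *m A.2).

(* C^oo: all iterated derivatives of f along left-invariant fields exist and  *)
(* are differentiable. As these fields frame the tangent bundle, it suffices  *)
(* that f lies in a family of differentiable functions that is stable under   *)
(* differentiation along them.                                                *)
Definition smooth (f : G -> R) : Prop :=
  exists S : set (G -> R), S f /\
    forall h, S h ->
      (forall x, differentiable_at h x) /\
      (forall A, tangent 1%g A -> S (fun x => dirderiv h x (left_field A x))).

Definition smooth_map (phi : G -> G) : Prop :=
  forall k, smooth (fun x => rcoord k (embed (phi x))).

Definition differential (phi : G -> G) (x : G) (u : V) : V :=
  of_rcoord (fun k => dirderiv (fun y => rcoord k (embed (phi y))) x u).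

Definition vector_field (X : G -> V) : Prop :=
  (forall x, tangent x (X x)) /\ (forall k, smooth (fun x => rcoord k (X x))).

Definition along (X : G -> V) (f : G -> R) : G -> R :=
  fun x => dirderiv f x (X x).

(* The k-th coordinate of [X, Y] is the derivation X Y - Y X applied to the   *)
(* k-th ambient coordinate function, since the latter has derivative rcoord k  *)
(* (Y x) along Y.                                                             *)
Definition lie_bracket (X Y : G -> V) : G -> V := fun x =>
  of_rcoord (fun k => along X (fun y => rcoord k (Y y)) x -
                     along Y (fun y => rcoord k (X y)) x).

(* Only the values of g x on vectors tangent at x are relevant.               *)
Definition metric := G -> V -> V -> R.

Definition riemannian (g : metric) : Prop :=
  [/\ (forall x u v, tangent x u -> tangent x v -> g x u v = g x v u),
      (forall x (a : R) u v w, tangent x u -> tangent x v -> tangent x w ->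
         g x (a%:C *: u + v) w = a * g x u w + g x v w),
      (forall x u, tangent x u -> u != 0 -> 0 < g x u u) &
      (forall X Y, vector_field X -> vector_field Y ->
         smooth (fun x => g x (X x) (Y x)))].

Definition isometries (g : metric) : set (G -> G) :=
  [set phi : G -> G | exists psi : G -> G,
    [/\ cancel phi psi, cancel psi phi, smooth_map phi, smooth_map psi &
        forall x u v, tangent x u -> tangent x v ->
          g (phi x) (differential phi x u) (differential phi x v) = g x u v]].

Definition left_invariant (g : metric) : Prop :=
  forall a : G, isometries g (fun x => a * x)%g.

Definition inn : set (G -> G) :=
  [set phi : G -> G | exists a : G, phi = (fun x => a * x * a^-1)%g].

Definition inner_isotropy (g : metric) : set (G -> G) := isometries g `&` inn.

Definition levi_civita (g : metric)
    (nabla : (G -> V) -> (G -> V) -> (G -> V)) : Prop :=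
  [/\ (forall X Y, vector_field X -> vector_field Y ->
         vector_field (nabla X Y)),
      (forall f X X' Y, smooth f ->
         vector_field X -> vector_field X' -> vector_field Y ->
         nabla (fun x => (f x)%:C *: X x + X' x) Y =
         fun x => (f x)%:C *: nabla X Y x + nabla X' Y x),
      (forall f X Y Y', smooth f ->
         vector_field X -> vector_field Y -> vector_field Y' ->
         nabla X (fun x => (f x)%:C *: Y x + Y' x) =
         fun x => (along X f x)%:C *: Y x + (f x)%:C *: nabla X Y x
                  + nabla X Y' x),
      (forall X Y, vector_field X -> vector_field Y ->
         (fun x => nabla X Y x - nabla Y X x) = lie_bracket X Y) &
      (forall X Y Z, vector_field X -> vector_field Y -> vector_field Z ->
         along X (fun x => g x (Y x) (Z x)) =
         fun x => g x (nabla X Y x) (Z x) + g x (Y x) (nabla X Z x))].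

Definition curvature (nabla : (G -> V) -> (G -> V) -> (G -> V))
    (X Y Z : G -> V) : G -> V := fun x =>
  nabla X (nabla Y Z) x - nabla Y (nabla X Z) x - nabla (lie_bracket X Y) Z x.

(* Ric(Y, Z) at x as the trace of U |-> R(U, Y) Z, in a frame E orthonormal   *)
(* at x (dim G = 6).                                                          *)
Definition ricci (g : metric) nabla (E : 'I_6 -> G -> V) (Y Z : G -> V)
    (x : G) : R :=
  \sum_(i < 6) g x (curvature nabla (E i) Y Z x) (E i x).

Definition einstein (g : metric) (lambda : R) : Prop :=
  exists2 nabla, levi_civita g nabla &
    forall x (E : 'I_6 -> G -> V) Y Z,
      (forall i, vector_field (E i)) ->
      (forall i j, g x (E i x) (E j x) = (i == j)%:R) ->
      vector_field Y -> vector_field Z ->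
      ricci g nabla E Y Z x = lambda * g x (Y x) (Z x).

End RiemannianGeometry.

(* Main.v *)
Require Import Defs.
From mathcomp Require Import all_boot all_order all_algebra.
From mathcomp Require Import all_classical all_reals all_analysis.
From mathcomp Require Import complex ring lra.
Set Implicit Arguments.
Unset Strict Implicit.
Unset Printing Implicit Defensive.
Import Order.TTheory GRing.Theory Num.Theory numFieldNormedType.Exports.
Local Open Scope classical_set_scope.
Local Open Scope ring_scope.

(** Identify the Lie algebra of SU(2) x SU(2) with R^3 + R^3, the bracket being
    the cross product on each summand.  A left-invariant metric is an inner
    product q there, and Koszul's formula turns the Einstein equation into an
    algebraic condition on q ([einstein_metric1]).  The proof shows that an
    Einstein q is invariant under the half turns about some vector x of the
    first summand and y of the second, simultaneously ([einstein_half_turn]).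
    Conjugation by the unit quaternions in the directions of x and y induces
    these half turns, so it is a nonidentity inner isometry.

    Choose q-orthonormal bases u_i, v_i of the two summands with
    q(u_i, v_j) = 0 for i <> j; they exist by the singular value decomposition
    ([principal_bases]).  Write q(u_i, v_i) = - t_i, k_i = sqrt (1 - t_i^2),
    uhat_i = u_i / k_i and vhat_i = v_i / k_i.  The cross products of the
    uhat_i are described by a symmetric matrix X, those of the vhat_i by a
    symmetric matrix M, and adj X and adj M are the Euclidean Gram matrices of
    the two bases ([structure_adj]).  If X and M are diagonal, both bases are
    orthogonal for the dot product, and the half turns about uhat_0 and vhat_0
    multiply uhat_i and vhat_i by the same sign for every i, so that they
    preserve q.  It remains to see that the off-diagonal entries vanish.

    The Einstein equation with constant lambda has two consequences that are
    used.  A vector n orthogonal to the second summand and a vector e of the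
    first give Ric(n, e) as a derivative of the scalar curvature along linear
    maps acting on the first summand only; this yields, for every index,
      det X ((1 + h) x - t (h - 1) y) = - 2 lambda (adj X)_offdiag,
    where x and y are the off-diagonal entries of X and M at that index and
    h >= 1 is the mean of two of the k_i^-2.  The trace of Ric on the
    orthogonal complement of the first summand is bounded by the scalar
    curvature of the quotient by that summand (O'Neill's formula), whence
    6 lambda <= (tr M)^2 - 2 tr M^2.  Exchanging the summands gives the same
    statements with X and M exchanged ([frame_equations]).

    Finally 4 adj X = (tr X - 2 X)^2 + ((tr X)^2 - 2 tr X^2), so the second
    consequence bounds the quadratic form 6 lambda X / det X by 4 times the
    squared length.  On the vector (x_0, x_1, - 2 x_2), the first consequence
    evaluates this form; adding the same for M, one gets at least 6 times the
    sum of the squared lengths of the two test vectors.  Hence both vectors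
    vanish ([offdiag_eq0]). *)

(** * Symmetric matrices of size three *)

(** The entry [oi] is the off-diagonal one whose row and column both differ
    from [i].  Explicit entries let polynomial identities between such matrices
    be decided by computation. *)
Record sym3 (R : Type) := Sym3 { d0 : R; d1 : R; d2 : R; o0 : R; o1 : R; o2 : R }.

Section Sym3.
Variable R : comRingType.
Implicit Types A : sym3 R.
Definition adj3 A : sym3 R := Sym3
  (d1 A * d2 A - o0 A ^+ 2) (d2 A * d0 A - o1 A ^+ 2) (d0 A * d1 A - o2 A ^+ 2)
  (o1 A * o2 A - o0 A * d0 A) (o2 A * o0 A - o1 A * d1 A) (o0 A * o1 A - o2 A * d2 A).
Definition det3 A := d0 A * d1 A * d2 A + 2 * (o0 A * o1 A * o2 A)
  - d0 A * o0 A ^+ 2 - d1 A * o1 A ^+ 2 - d2 A * o2 A ^+ 2.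
Definition quad3 A (w : R * R * R) := let: (a, b, c) := w in
  d0 A * a ^+ 2 + d1 A * b ^+ 2 + d2 A * c ^+ 2
  + 2 * (o0 A * (b * c) + o1 A * (c * a) + o2 A * (a * b)).
(** This is (tr A)^2 - 2 tr A^2, twice the scalar curvature of the
    three-dimensional unimodular metric Lie algebra with structure matrix A. *)
Definition scal3 A := (d0 A + d1 A + d2 A) ^+ 2
  - 2 * (d0 A ^+ 2 + d1 A ^+ 2 + d2 A ^+ 2 + 2 * (o0 A ^+ 2 + o1 A ^+ 2 + o2 A ^+ 2)).
End Sym3.

(** * Singular values and Cholesky factors *)

Section LA.
Variable R : rcfType.

Lemma sqnorm_gt0 n (v : 'rV[R]_n) : v != 0 -> 0 < (v *m v^T) 0 0.
Proof.
move=> v0; have ge0 i : true -> 0 <= v 0 i * v^T i 0 by rewrite mxE -expr2 sqr_ge0.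
rewrite mxE lt_def sumr_ge0 ?andbT //.
apply: contra v0 => /eqP s0; apply/eqP/rowP => j; rewrite mxE.
by have /eqP := psumr_eq0P ge0 s0 (isT : xpredT j); rewrite mxE mulf_eq0 orbb => /eqP.
Qed.

(** Over the algebraic closure there is an eigenvalue mu; comparing v S v^*
    with its conjugate shows that mu is real, and a real root of the
    characteristic polynomial has a real eigenvector. *)
Lemma symmetric_eigenvector n (S : 'M[R]_n.+1) : S^T = S ->
  exists2 v : 'rV[R]_n.+1, v != 0 & exists a, v *m S = a *: v.
Proof.
move=> Ssym.
pose SC := map_mx (real_complex R) S.
have [mu] : exists mu, root (char_poly SC) mu.
  by apply: closed_rootP; rewrite size_char_poly.
rewrite -eigenvalue_root_char => /eigenvalueP[v vS v0].
have SCsym : SC^T = SC by rewrite /SC map_trmx Ssym.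
pose nv := (v *m (map_mx Num.conj v)^T) 0 0.
have nv_gt0 : 0 < nv.
  have ge0 i : true -> 0 <= v 0 i * (map_mx Num.conj v)^T i 0.
    by move=> _; rewrite !mxE mul_conjC_ge0.
  rewrite /nv mxE lt_def sumr_ge0 ?andbT //.
  apply: contra v0 => /eqP s0; apply/eqP/rowP => j; rewrite mxE.
  by have /eqP := psumr_eq0P ge0 s0 (isT : xpredT j); rewrite !mxE mul_conjC_eq0 => /eqP.
have mur : mu^* = mu.
  have E1 : (v *m SC *m (map_mx Num.conj v)^T) 0 0 = mu * nv.
    by rewrite vS -scalemxAl mxE.
  have E2 : (v *m SC *m (map_mx Num.conj v)^T) 0 0 = mu^* * nv.
    have SCreal : map_mx Num.conj SC = SC.
      by apply/matrixP => i j; rewrite !mxE; apply/eqP; rewrite eq_complex /= oppr0 !eqxx.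
    have -> : v *m SC *m (map_mx Num.conj v)^T = v *m (map_mx Num.conj (v *m SC))^T.
      by rewrite map_mxM trmx_mul SCreal SCsym mulmxA.
    rewrite vS -[in RHS]/nv.
    have -> : map_mx Num.conj (mu *: v) = mu^* *: map_mx Num.conj v.
      by apply/matrixP => i j; rewrite !mxE rmorphM.
    by rewrite linearZ -scalemxAr mxE.
  by apply/(mulIf (lt0r_neq0 nv_gt0)); rewrite -E1 -E2.
have [a mua] : exists a : R, mu = a%:C%C.
  exists (complex.Re mu); case: mu mur {vS} => x y /= [] /eqP.
  by rewrite -subr_eq0 -opprD oppr_eq0 -mulr2n mulrn_eq0 /= => /eqP ->.
have : root (char_poly S) a.
  rewrite -(fmorph_root (real_complex R)) map_char_poly /= -mua.
  by rewrite -eigenvalue_root_char; apply/eigenvalueP; exists v.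
rewrite -eigenvalue_root_char => /eigenvalueP[w wS w0].
by exists w => //; exists a.
Qed.

Lemma mx11_scale m (a : 'M[R]_1) (v : 'M[R]_(1, m)) : a *m v = a 0 0 *: v.
Proof. by rewrite [a in LHS]mx11_scalar mul_scalar_mx. Qed.

Lemma mx11_one (M : 'M[R]_1) : M = 1%:M -> M 0 0 = 1.
Proof. by move=> ->; rewrite mxE. Qed.

Lemma sqnormZ n (a : R) (v : 'rV[R]_n) :
  ((a *: v) *m (a *: v)^T) 0 0 = a ^+ 2 * (v *m v^T) 0 0.
Proof. by rewrite linearZ /= -scalemxAl -scalemxAr scalerA mxE expr2. Qed.

(** The reflection in the hyperplane orthogonal to u - e, with e the first
    coordinate vector, exchanges e and u. *)
Lemma orthogonal_completion n (u : 'rV[R]_n.+1) : u *m u^T = 1%:M ->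
  exists2 H : 'M[R]_n.+1, H *m H^T = 1%:M & delta_mx 0 0 *m H = u.
Proof.
move=> uu; pose e : 'rV[R]_n.+1 := delta_mx 0 0.
have [w wE] : exists w, w = u - e by exists (u - e).
have ee : e *m e^T = 1%:M.
  by rewrite trmx_delta mul_delta_mx; apply/matrixP => i j; rewrite !mxE !ord1.
have eu : u *m e^T = e *m u^T.
  by rewrite -[LHS]trmxK trmx_mul trmxK; apply/matrixP => i j; rewrite !ord1 !mxE.
have [w0|w0] := eqVneq w 0.
  exists 1%:M; first by rewrite trmx1 mulmx1.
  by rewrite mulmx1; apply/eqP; rewrite eq_sym -subr_eq0 -wE w0.
(* The reflection with axis w. *)
pose c := 2 / (w *m w^T) 0 0.
have ww0 : (w *m w^T) 0 0 != 0 by rewrite gt_eqF ?sqnorm_gt0.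
pose H := 1%:M - c *: (w^T *m w).
have HT : H^T = H by rewrite linearB linearZ /= trmx1 trmx_mul trmxK.
exists H.
  have K : w^T *m w *m (w^T *m w) = (w *m w^T) 0 0 *: (w^T *m w).
    by rewrite mulmxA -[w^T *m w *m w^T]mulmxA -mulmxA mx11_scale -scalemxAr.
  rewrite HT /H mulmxBl mul1mx mulmxBr mulmx1 -scalemxAl -scalemxAr K !scalerA.
  have -> : c * c * (w *m w^T) 0 0 = c + c.
    by rewrite -mulrA [c * (w *m _) _ _]divfK //; ring.
  by rewrite scalerDl opprB addrK subrK.
rewrite /H mulmxBr mulmx1 -scalemxAr mulmxA mx11_scale scalerA.
have -> : c * (e *m w^T) 0 0 = -1.
  have E : (w *m w^T) 0 0 = - 2 * (e *m w^T) 0 0 :> R.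
    have -> : w *m w^T = 1%:M + 1%:M - (e *m u^T + e *m u^T).
      by rewrite wE linearB /= mulmxBl !mulmxBr uu ee eu opprB addrACA -opprD addrC.
    by rewrite wE linearB /= mulmxBr ee !mxE /=; ring.
  have z0 : (e *m w^T) 0 0 != 0.
    by apply: contra_neq ww0 => z0; rewrite E z0 mulr0.
  by rewrite /c E; field.
by rewrite scaleN1r opprK wE addrC subrK.
Qed.

Lemma exists_unit_multiple n (v : 'rV[R]_n) : v != 0 ->
  exists2 a : R, a != 0 & (a *: v : 'rV_n) *m (a *: v)^T = 1%:M.
Proof.
move=> v0; have vv := sqnorm_gt0 v0; set d := (v *m v^T) 0 0 in vv.
exists (Num.sqrt d)^-1; first by rewrite invr_eq0 gt_eqF ?sqrtr_gt0.
rewrite linearZ -scalemxAl -scalemxAr scalerA -expr2 exprVn sqr_sqrtr ?ltW //.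
by apply/matrixP => i j; rewrite !ord1 mxE -/d mulVf ?gt_eqF // mxE.
Qed.

(** Take u an eigenvector of N N^T and v the normalised image u N.  If that
    image vanishes then N is singular, and any v in the kernel of N^T works
    with s = 0. *)
Lemma singular_pair n (N : 'M[R]_n.+1) :
  exists (u v : 'rV[R]_n.+1) (s : R),
  [/\ u *m u^T = 1%:M, v *m v^T = 1%:M, u *m N = s *: v & N *m v^T = s *: u^T].
Proof.
have [w w0 [a wa]] : exists2 w : 'rV_n.+1, w != 0 &
    exists a, w *m (N *m N^T) = a *: w.
  by apply: symmetric_eigenvector; rewrite trmx_mul trmxK.
have [b b0 ww] := exists_unit_multiple w0.
have [wN|wN] := eqVneq (w *m N) 0; last first.
  have [c c0 vv] := exists_unit_multiple wN.
  exists (b *: w), (c *: (w *m N)), (b / c); split=> //.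
    by rewrite scalerA divfK // scalemxAl.
  apply: trmx_inj; rewrite trmx_mul (trmxK (c *: (w *m N))) -scalemxAl -mulmxA wa.
  rewrite [RHS]linearZ /= (trmxK (b *: w)).
  rewrite !scalerA; congr (_ *: _).
  have aE : a * (c ^+ 2 * (w *m w^T) 0 0) = 1.
    rewrite -[RHS](mx11_one vv) sqnormZ trmx_mul mulmxA -[w *m N *m N^T]mulmxA.
    by rewrite wa -scalemxAl [in RHS]mxE mulrCA.
  have bE : b ^+ 2 * (w *m w^T) 0 0 = 1 by rewrite -[RHS](mx11_one ww) sqnormZ.
  move: aE bE; set d := (w *m w^T) 0 0 => aE bE.
  have bcE : b ^+ 2 = a * c ^+ 2.
    have : b ^+ 2 * (a * (c ^+ 2 * d)) = a * c ^+ 2 * (b ^+ 2 * d) by ring.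
    by rewrite aE bE !mulr1.
  have -> : b / c * b = b ^+ 2 / c by ring.
  by rewrite bcE; field.
have : \det N^T == 0 by rewrite det_tr; apply/det0P; exists w.
case/det0P => v v0 vN; have [c c0 vv] := exists_unit_multiple v0.
exists (b *: w), (c *: v), 0; split=> //.
  by rewrite -scalemxAl wN scaler0 scale0r.
by apply: trmx_inj; rewrite trmx_mul trmxK -scalemxAl vN scaler0 scale0r trmx0.
Qed.

Lemma orthogonalM n (A B : 'M[R]_n) :
  A *m A^T = 1%:M -> B *m B^T = 1%:M -> (A *m B) *m (A *m B)^T = 1%:M.
Proof. by move=> AA BB; rewrite trmx_mul mulmxA -[A *m B *m _]mulmxA BB mulmx1. Qed.

Lemma orthogonal_block n (A : 'M[R]_n) : A *m A^T = 1%:M ->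
  block_mx 1%:M 0 0 A *m (block_mx 1%:M 0 0 A)^T = 1%:M :> 'M[R]_(1 + n).
Proof.
move=> AA; rewrite tr_block_mx mulmx_block !trmx0 trmx1 !mulmx1 !mulmx0 !mul0mx.
by rewrite AA !addr0 add0r -scalar_mx_block.
Qed.

(** Completing a singular pair to orthogonal matrices on both sides splits off
    a 1 x 1 block, and the induction continues in the other block. *)
Lemma svd n (N : 'M[R]_n) : exists U V : 'M[R]_n,
  [/\ U *m U^T = 1%:M, V *m V^T = 1%:M & is_diag_mx (U *m N *m V^T)].
Proof.
elim: n N => [|n IH] N.
  exists 1%:M, 1%:M; split; rewrite ?trmx1 ?mulmx1 //.
  by apply/is_diag_mxP => -[].
have [u [v [s [uu vv uN Nv]]]] := singular_pair N.
have [H HH He] := orthogonal_completion uu.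
have [K KK Ke] := orthogonal_completion vv.
have [N' N'def] : exists N' : 'M[R]_n.+1, N' = H *m N *m K^T by eexists.
have [U1 [V1 [UU VV D]]] := IH (drsubmx (N' : 'M[R]_(1 + n))).
have row0 : (delta_mx 0 0 : 'rV_n.+1) *m N' = s *: (delta_mx 0 0 : 'rV_n.+1).
  by rewrite N'def !mulmxA He uN -Ke -scalemxAl -mulmxA KK mulmx1.
have col0 : N' *m delta_mx 0 0 = s *: (delta_mx 0 0 : 'cV_n.+1).
  rewrite N'def -mulmxA -[delta_mx 0 0 in LHS]trmxK trmx_delta -trmx_mul Ke -mulmxA Nv.
  by rewrite -He -scalemxAr trmx_mul trmx_delta mulmxA HH mul1mx.
have N'E : N' = block_mx (s%:M : 'M[R]_1) 0 0 (drsubmx (N' : 'M[R]_(1 + n))) :> 'M[R]_(1 + n).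
  have e0 : lshift n 0 = 0 :> 'I_(1 + n) by apply: val_inj.
  have r j : N' 0 j = s * (j == 0)%:R.
    by have := congr1 (fun M : 'rV_n.+1 => M 0 j) row0; rewrite -rowE !mxE eqxx.
  have c i : N' i 0 = s * (i == 0)%:R.
    by have := congr1 (fun M : 'cV_n.+1 => M i 0) col0; rewrite -colE !mxE eqxx andbT.
  rewrite -[LHS](@submxK _ 1 n 1 n); congr block_mx; apply/matrixP => i j; rewrite !mxE.
  - by rewrite !ord1 e0 r mulr1.
  - by rewrite !ord1 e0 r mulr0.
  - by rewrite !ord1 e0 c mulr0.
pose A (B : 'M[R]_n) : 'M[R]_n.+1 := block_mx (1%:M : 'M[R]_1) 0 0 B : 'M[R]_(1 + n).
have AA B : B *m B^T = 1%:M -> A B *m (A B)^T = 1%:M by exact: orthogonal_block.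
exists (A U1 *m H), (A V1 *m K); split.
- exact: orthogonalM (AA _ UU) HH.
- exact: orthogonalM (AA _ VV) KK.
have -> : A U1 *m H *m N *m (A V1 *m K)^T = A U1 *m N' *m (A V1)^T.
  by rewrite N'def trmx_mul !mulmxA.
rewrite N'E /A (@tr_block_mx _ 1 n 1 n) !(@mulmx_block _ 1 n 1 n 1 n) !trmx0 trmx1.
rewrite !mulmx1 !mul1mx !mulmx0 !mul0mx !addr0 !add0r (@is_diag_block_mx _ 1 n 1 n) //.
by rewrite mul0mx !eqxx scalar_mx_is_diag D.
Qed.

(** Clearing the first row and column leaves the Schur complement, which is
    again positive definite. *)
Lemma cholesky n (P : 'M[R]_n) : P^T = P ->
  (forall v : 'rV_n, v != 0 -> 0 < (v *m P *m v^T) 0 0) ->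
  exists U : 'M[R]_n, U *m P *m U^T = 1%:M.
Proof.
elim: n P => [|n IH] P Psym Ppos; first by exists 1%:M; apply/matrixP => -[].
pose p := ulsubmx (P : 'M[R]_(1 + n)); pose b := ursubmx (P : 'M[R]_(1 + n)).
pose D := drsubmx (P : 'M[R]_(1 + n)).
have pE : p = (p 0 0)%:M by exact: mx11_scalar.
have PE : P = block_mx p b b^T D :> 'M[R]_(1 + n).
  rewrite -[LHS](@submxK _ 1 n 1 n) -/p -/b -/D; congr block_mx.
  by rewrite /b trmx_ursub Psym.
have Pform (x : 'rV_1) (y : 'rV_n) : (row_mx x y : 'rV_n.+1) *m P *m (row_mx x y)^T =
    (x *m p + y *m b^T) *m x^T + (x *m b + y *m D) *m y^T.
  rewrite PE (@mul_row_block _ 1 1 n 1 n) (@tr_row_mx _ 1 1 n).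
  by rewrite (@mul_row_col _ 1 1 n 1).
pose a := p 0 0.
have p_gt0 : 0 < a.
  have := Ppos (row_mx (1%:M : 'rV_1) (0 : 'rV_n) : 'rV_(1 + n)).
  rewrite Pform !mul0mx trmx0 !mulmx0 !addr0 trmx1 mulmx1 mul1mx; apply.
  by rewrite (@row_mx_eq0 _ 1 1 n) negb_and oner_eq0.
have a0 : a != 0 by rewrite gt_eqF.
have DT : D^T = D by rewrite /D trmx_drsub Psym.
have [U1 UU] : exists U1 : 'M[R]_n, U1 *m (D - a^-1 *: (b^T *m b)) *m U1^T = 1%:M.
  apply: IH.
    by rewrite linearB linearZ /= DT trmx_mul trmxK.
  move=> y y0.
  have := Ppos (row_mx (- a^-1 *: (y *m b^T)) y : 'rV_(1 + n)).
  rewrite (@row_mx_eq0 _ 1 1 n) negb_and y0 orbT Pform => /(_ isT).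
  rewrite pE mul_mx_scalar scalerA -/a mulrN divff // scaleN1r addNr mul0mx add0r.
  by rewrite mulmxBr addrC -!scalemxAl scaleNr -scalemxAr mulmxA.
pose r := Num.sqrt a; have r0 : r != 0 by rewrite gt_eqF ?sqrtr_gt0.
have rr : r * r = a by rewrite -expr2 sqr_sqrtr ?ltW.
exists (block_mx (r^-1)%:M 0 (- a^-1 *: (U1 *m b^T)) U1 : 'M[R]_(1 + n)).
rewrite PE (@tr_block_mx _ 1 n 1 n) !(@mulmx_block _ 1 n 1 n 1 n).
rewrite !trmx0 tr_scalar_mx !mulmx0 !mul0mx !addr0.
have -> : - a^-1 *: (U1 *m b^T) *m p + U1 *m b^T = 0.
  by rewrite pE mul_mx_scalar scalerA -/a mulrN divff // scaleN1r addNr.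
rewrite !mul0mx !add0r [RHS](@scalar_mx_block _ 1 n); congr (@block_mx _ 1 n 1 n _ _ _ _).
- by rewrite pE -!scalar_mxM -/a -rr; congr _%:M; field.
- rewrite linearZ /= trmx_mul trmxK pE -scalar_mxM mul_scalar_mx scalerA mul_scalar_mx.
  by rewrite -scalemxAl -/a mulrN mulrAC divfK // scaleNr addNr.
- by rewrite -UU mulmxBr addrC -!scalemxAl -scalemxAr scaleNr mulmxA.
Qed.

End LA.

(** * The inequality that makes the frames orthogonal *)

Section Ineq.
Variable R : realFieldType.

(** With w = A (a, b, c) / det A, the left-hand form is 3 sigma times the form
    of adj A at w, while (a, b, c) = (adj A) w.  The identity
    4 adj A = (tr A - 2 A)^2 + scal3 A expresses 4 |(adj A) w|^2 as
    scal3 A (adj A)(w) plus the nonnegative value of adj A at (tr A - 2 A) w. *)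
Lemma adj_bound (X : sym3 R) (sigma a b c : R) : det3 X != 0 ->
  (forall w, 0 <= quad3 (adj3 X) w) -> 3 * sigma <= scal3 X ->
  3 * sigma * (quad3 X (a, b, c) / det3 X) <= 4 * (a ^+ 2 + b ^+ 2 + c ^+ 2).
Proof.
case: X => x y z p q r; set X := Sym3 _ _ _ _ _ _ => D0 psd scal.
pose D := det3 X.
pose w0 := (x * a + r * b + q * c) / D; pose w1 := (r * a + y * b + p * c) / D.
pose w2 := (q * a + p * b + z * c) / D; pose t := x + y + z.
have E1 : quad3 X (a, b, c) / D = quad3 (adj3 X) (w0, w1, w2).
  by rewrite /w0 /w1 /w2 /D /quad3 /=; move: D0; rewrite /det3 /= => D0; field.
have E2 : 4 * (a ^+ 2 + b ^+ 2 + c ^+ 2) = scal3 X * quad3 (adj3 X) (w0, w1, w2)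
  + quad3 (adj3 X) (t * w0 - 2 * (x * w0 + r * w1 + q * w2),
     t * w1 - 2 * (r * w0 + y * w1 + p * w2), t * w2 - 2 * (q * w0 + p * w1 + z * w2)).
  have -> : a = d0 (adj3 X) * w0 + o2 (adj3 X) * w1 + o1 (adj3 X) * w2.
    by rewrite /w0 /w1 /w2 /D /=; move: D0; rewrite /det3 /= => D0; field.
  have -> : b = o2 (adj3 X) * w0 + d1 (adj3 X) * w1 + o0 (adj3 X) * w2.
    by rewrite /w0 /w1 /w2 /D /=; move: D0; rewrite /det3 /= => D0; field.
  have -> : c = o1 (adj3 X) * w0 + o0 (adj3 X) * w1 + d2 (adj3 X) * w2.
    by rewrite /w0 /w1 /w2 /D /=; move: D0; rewrite /det3 /= => D0; field.
  by rewrite /t /quad3 /scal3 /=; ring.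
rewrite -/D E1 E2; apply: ler_wpDr; first exact: psd.
by apply: ler_wpM2r => //; exact: psd.
Qed.

(** The form of 3 sigma A / det A is evaluated at (o0, o1, - 2 o2) for A = X and
    for A = M.  By the six equations the sum of the two values is at least
    6 times the sum of the squared entries with weights 1, 1, 4, and by
    [adj_bound] it is at most 4 times that same sum. *)
Lemma offdiag_eq0 (X M : sym3 R) (sigma h0 h1 h2 t0 t1 t2 : R) :
  det3 X != 0 -> det3 M != 0 ->
  (forall w, 0 <= quad3 (adj3 X) w) -> (forall w, 0 <= quad3 (adj3 M) w) ->
  3 * sigma <= scal3 X -> 3 * sigma <= scal3 M ->
  1 <= h0 -> 1 <= h1 -> 1 <= h2 -> `|t0| <= 1 -> `|t1| <= 1 -> `|t2| <= 1 ->
  det3 X * ((1 + h0) * o0 X - t0 * (h0 - 1) * o0 M) = - sigma * o0 (adj3 X) ->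
  det3 X * ((1 + h1) * o1 X - t1 * (h1 - 1) * o1 M) = - sigma * o1 (adj3 X) ->
  det3 X * ((1 + h2) * o2 X - t2 * (h2 - 1) * o2 M) = - sigma * o2 (adj3 X) ->
  det3 M * ((1 + h0) * o0 M - t0 * (h0 - 1) * o0 X) = - sigma * o0 (adj3 M) ->
  det3 M * ((1 + h1) * o1 M - t1 * (h1 - 1) * o1 X) = - sigma * o1 (adj3 M) ->
  det3 M * ((1 + h2) * o2 M - t2 * (h2 - 1) * o2 X) = - sigma * o2 (adj3 M) ->
  [/\ o0 X = 0, o1 X = 0 & o2 X = 0] /\ [/\ o0 M = 0, o1 M = 0 & o2 M = 0].
Proof.
move=> DX DM pX pM sX sM h0_ge h1_ge h2_ge t0_le t1_le t2_le.
move=> EX0 EX1 EX2 EM0 EM1 EM2.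
(* The weights 1, 1, -2 have sum zero, which makes the coefficients of the
   product o0 o1 o2 agree: the form of A at the test vector then only involves
   the off-diagonal entries of adj A, known from the hypotheses. *)
have test (A B : sym3 R) : det3 A != 0 ->
    det3 A * ((1 + h0) * o0 A - t0 * (h0 - 1) * o0 B) = - sigma * o0 (adj3 A) ->
    det3 A * ((1 + h1) * o1 A - t1 * (h1 - 1) * o1 B) = - sigma * o1 (adj3 A) ->
    det3 A * ((1 + h2) * o2 A - t2 * (h2 - 1) * o2 B) = - sigma * o2 (adj3 A) ->
    3 * sigma * (quad3 A (o0 A, o1 A, - 2 * o2 A) / det3 A) =
    3 * (o0 A * ((1 + h0) * o0 A - t0 * (h0 - 1) * o0 B) +
         o1 A * ((1 + h1) * o1 A - t1 * (h1 - 1) * o1 B) +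
    4 * (o2 A * ((1 + h2) * o2 A - t2 * (h2 - 1) * o2 B))).
  move=> DA E0 E1 E2; apply: (mulIf DA).
  have -> : 3 * sigma * (quad3 A (o0 A, o1 A, - 2 * o2 A) / det3 A) * det3 A =
      3 * sigma * quad3 A (o0 A, o1 A, - 2 * o2 A) by field.
  have -> : quad3 A (o0 A, o1 A, - 2 * o2 A) =
      - (o0 A * o0 (adj3 A) + o1 A * o1 (adj3 A) + 4 * (o2 A * o2 (adj3 A))).
    by rewrite /quad3 /=; ring.
  transitivity (3 * (o0 A * (- sigma * o0 (adj3 A)) + o1 A * (- sigma * o1 (adj3 A))
    + 4 * (o2 A * (- sigma * o2 (adj3 A))))); first by ring.
  by rewrite -E0 -E1 -E2; ring.
(* The difference is (h - 1) / 2 times a combination of two squares with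
   nonnegative weights 1 + t and 1 - t. *)
have pair_bound (x y h t : R) : 1 <= h -> `|t| <= 1 -> 2 * (x ^+ 2 + y ^+ 2) <=
    x * ((1 + h) * x - t * (h - 1) * y) + y * ((1 + h) * y - t * (h - 1) * x).
  move=> h1' t1'; rewrite -subr_ge0.
  have [tl tu] : -1 <= t /\ t <= 1 by move: t1'; rewrite ler_norml => /andP.
  have -> : x * ((1 + h) * x - t * (h - 1) * y) + y * ((1 + h) * y - t * (h - 1) * x)
     - 2 * (x ^+ 2 + y ^+ 2) = (h - 1) * ((1 + t) * (x - y) ^+ 2 + (1 - t) * (x + y) ^+ 2) / 2.
    by field.
  by rewrite divr_ge0 // mulr_ge0 ?subr_ge0 // addr_ge0 // mulr_ge0 ?sqr_ge0 //; lra.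
have := adj_bound (o0 X) (o1 X) (- 2 * o2 X) DX pX sX.
have := adj_bound (o0 M) (o1 M) (- 2 * o2 M) DM pM sM.
rewrite (test _ _ DX EX0 EX1 EX2) (test _ _ DM EM0 EM1 EM2).
have := pair_bound (o0 X) (o0 M) _ _ h0_ge t0_le; have := pair_bound (o1 X) (o1 M) _ _ h1_ge t1_le.
have := pair_bound (o2 X) (o2 M) _ _ h2_ge t2_le.
have := sqr_ge0 (o0 X); have := sqr_ge0 (o1 X); have := sqr_ge0 (o2 X).
have := sqr_ge0 (o0 M); have := sqr_ge0 (o1 M); have := sqr_ge0 (o2 M).
have -> : (- 2 * o2 X) ^+ 2 = 4 * o2 X ^+ 2 by ring.
have -> : (- 2 * o2 M) ^+ 2 = 4 * o2 M ^+ 2 by ring.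
set a := o0 X ^+ 2; set b := o1 X ^+ 2; set c := o2 X ^+ 2.
set d := o0 M ^+ 2; set e := o1 M ^+ 2; set f := o2 M ^+ 2.
move=> f0 e0 d0' c0 b0 a0 P2 P1 P0 BM BX.
have S_le0 : a + b + 4 * c + (d + e + 4 * f) <= 0.
  by move: P2 P1 P0 BM BX; rewrite -/a -/b -/c -/d -/e -/f; clear; lra.
have [[a_eq b_eq c_eq] [d_eq e_eq f_eq]] :
    [/\ a = 0, b = 0 & c = 0] /\ [/\ d = 0, e = 0 & f = 0].
  by move: f0 e0 d0' c0 b0 a0 S_le0; clear; split; split; lra.
have Z (u : R) : u ^+ 2 = 0 -> u = 0 by move/eqP; rewrite sqrf_eq0 => /eqP.
by split; split; apply: Z.
Qed.
End Ineq.

(** * The Ricci form of a metric Lie algebra *)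

Section RicciForm.
Variable R : comNzRingType.

(** Twice the Christoffel symbols of a left-invariant orthonormal frame with
    structure constants [c]; the factor avoids divisions. *)
Definition christoffel2 (c : nat -> nat -> nat -> R) a b d := c a b d - c b d a + c d a b.
Definition sum6 (F : nat -> R) := F 0%N + F 1%N + F 2%N + F 3%N + F 4%N + F 5%N.
(** Four times the Ricci tensor in that frame, so that products of two
    doubled Christoffel symbols need no denominator. *)
Definition ricci_form4 c y z := sum6 (fun a => sum6 (fun d =>
  christoffel2 c y z d * christoffel2 c a d a - christoffel2 c a z d * christoffel2 c y d a
  - (c a y d * christoffel2 c d z a) *+ 2)).
End RicciForm.

Section MetricLieAlgebra.
Variables (R : realFieldType) (V : lmodType R) (bracket : V -> V -> V) (q : V -> V -> R).
Hypothesis q_lin : forall a u v w, q (a *: u + v) w = a * q u w + q v w.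
Hypothesis q_sym : forall u v, q u v = q v u.
Hypothesis bracket_linl : forall a u v w, bracket (a *: u + v) w = a *: bracket u w + bracket v w.
Hypothesis bracket_linr : forall a u v w, bracket w (a *: u + v) = a *: bracket w u + bracket w v.

(** Koszul's expression for 2 q(nabla_A B, C); the three terms that differentiate
    the metric vanish for left-invariant fields. *)
Definition koszul A B C := q (bracket A B) C - q (bracket B C) A + q (bracket C A) B.

Lemma koszul_linl a u v B C :
  koszul (a *: u + v) B C = a * koszul u B C + koszul v B C.
Proof.
rewrite /koszul bracket_linl bracket_linr !q_lin [q _ (_ + _)]q_sym q_lin ![q _ (bracket B C)]q_sym.
by ring.
Qed.
Lemma koszul_linr a u v A C :
  koszul A (a *: u + v) C = a * koszul A u C + koszul A v C.
Proof.
rewrite /koszul bracket_linl bracket_linr !q_lin [q _ (_ + _)]q_sym q_lin ![q _ (bracket C A)]q_sym.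
by ring.
Qed.

Variable N : V -> V -> V.
Hypothesis NE : forall A B C, 2 * q (N A B) C = koszul A B C.
Variable E : nat -> V.
Hypothesis E_complete : forall w, w = \sum_(d < 6) q w (E d) *: E d.

Let c a b d := q (bracket (E a) (E b)) (E d).

Lemma linear_form_sum (f : V -> R) (F : 'I_6 -> R) :
  (forall a u v, f (a *: u + v) = a * f u + f v) ->
  f (\sum_(d < 6) F d *: E d) = \sum_(d < 6) F d * f (E d).
Proof.
move=> f_lin.
have f0 : f 0 = 0 by have := f_lin (-1) 0 0; rewrite scaler0 addr0 mulN1r addNr.
have fD u v : f (u + v) = f u + f v by rewrite -{1}[u]scale1r f_lin mul1r.
rewrite (big_morph f fD f0); apply: eq_bigr => d _.
by rewrite -[_ *: _]addr0 f_lin f0 addr0.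
Qed.

(** Inserting the decomposition of the inner connection term in the frame
    turns the curvature into products of two Koszul expressions. *)
Lemma ricci_frame y z :
  4 * \sum_(a < 6) q (N (E a) (N (E y) (E z)) - N (E y) (N (E a) (E z))
                      - N (bracket (E a) (E y)) (E z)) (E a) = ricci_form4 c y z.
Proof.
have qB u v w : q (u - v) w = q u w - q v w.
  by rewrite addrC -scaleN1r q_lin mulN1r addrC.
have expand2 A u C : koszul A u C = \sum_(d < 6) q u (E d) * koszul A (E d) C.
  rewrite {1}[u]E_complete (@linear_form_sum (fun u => koszul A u C)) // => *.
  exact: koszul_linr.
have expand1 u B C : koszul u B C = \sum_(d < 6) q u (E d) * koszul (E d) B C.
  rewrite {1}[u]E_complete (@linear_form_sum (fun u => koszul u B C)) // => *.
  exact: koszul_linl.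
have sum6E (F : nat -> R) : \sum_(a < 6) F a = sum6 F.
  by rewrite !big_ord_recl big_ord0 addr0 /sum6 /= !addrA.
have dbl A B C (x : R) : 2 * (q (N A B) C * x) = koszul A B C * x.
  by rewrite mulrA NE.
rewrite mulr_sumr /ricci_form4 -sum6E; apply: eq_bigr => a _; rewrite -sum6E !qB.
transitivity (2 * koszul (E a) (N (E y) (E z)) (E a)
  - 2 * koszul (E y) (N (E a) (E z)) (E a) - 2 * koszul (bracket (E a) (E y)) (E z) (E a)).
  by rewrite -!NE; ring.
rewrite (expand2 _ (N (E y) (E z))) (expand2 _ (N (E a) (E z))) (expand1 (bracket _ _)).
rewrite !mulr_sumr -!sumrB; apply: eq_bigr => d _.
by rewrite !dbl mulr_natl.
Qed.
End MetricLieAlgebra.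

(** * Ricci identities in the adapted frame *)

Section RicciTable.
Variable R : comNzRingType.

(** The sum of epsilon_ijk F(k) over k. *)
Definition eps (i j : nat) (F : nat -> R) : R := match i, j with
  | 0, 1 => F 2%N | 1, 2 => F 0%N | 2, 0 => F 1%N
  | 1, 0 => - F 2%N | 2, 1 => - F 0%N | 0, 2 => - F 1%N | _, _ => 0 end.

Definition entry (A : sym3 R) (i j : nat) : R := match i, j with
  | 0, 0 => d0 A | 1, 1 => d1 A | 2, 2 => d2 A
  | 1, 2 | 2, 1 => o0 A | 0, 2 | 2, 0 => o1 A | 0, 1 | 1, 0 => o2 A | _, _ => 0 end.

Section Table.
Variables (L M : sym3 R) (t0 t1 t2 : R).

Definition slope (i : nat) := match i with 0 => t0 | 1 => t1 | _ => t2 end.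

(** Structure constants q([E_a, E_b], E_d) of the adapted frame: the indices
    0, 1, 2 are orthonormal vectors e_i of the first factor, with structure
    matrix L, and 3, 4, 5 are the vectors f_i = vhat_i + t_i e_i orthogonal to
    that factor, with vhat_i in the second factor and structure matrix M. *)
Definition bracket_table (a b d : nat) : R := match a, b, d with
  | S (S (S i)), S (S (S j)), S (S (S l)) => eps i j (fun k => entry M k l)
  | S (S (S i)), S (S (S j)), l =>
      eps i j (fun k => slope i * slope j * entry L k l - slope l * entry M k l)
  | S (S (S i)), j, l =>
      match l with S (S (S _)) => 0 | _ => slope i * eps i j (fun k => entry L k l) end
  | i, S (S (S j)), l =>
      match l with S (S (S _)) => 0 | _ => slope j * eps i j (fun k => entry L k l) end
  | i, j, l => match l with S (S (S _)) => 0 | _ => eps i j (fun k => entry L k l) end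
  end.

(** Twice the gradient of the scalar curvature with respect to the symmetric
    matrix L, for the trace form and for fixed M and t. *)
Definition grad2 : sym3 R := Sym3
  (((1 + t2 ^+ 2) * d1 L + (1 + t1 ^+ 2) * d2 L
    - (1 + t1 ^+ 2) * (1 + t2 ^+ 2) * d0 L + t0 * t1 * t2 * d0 M) *+ 2)
  (((1 + t0 ^+ 2) * d2 L + (1 + t2 ^+ 2) * d0 L
    - (1 + t2 ^+ 2) * (1 + t0 ^+ 2) * d1 L + t0 * t1 * t2 * d1 M) *+ 2)
  (((1 + t1 ^+ 2) * d0 L + (1 + t0 ^+ 2) * d1 L
    - (1 + t0 ^+ 2) * (1 + t1 ^+ 2) * d2 L + t0 * t1 * t2 * d2 M) *+ 2)
  (t0 * (t1 ^+ 2 + t2 ^+ 2) * o0 M - (4 + t1 ^+ 2 + t2 ^+ 2) * (1 + t0 ^+ 2) * o0 L)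
  (t1 * (t2 ^+ 2 + t0 ^+ 2) * o1 M - (4 + t2 ^+ 2 + t0 ^+ 2) * (1 + t1 ^+ 2) * o1 L)
  (t2 * (t0 ^+ 2 + t1 ^+ 2) * o2 M - (4 + t0 ^+ 2 + t1 ^+ 2) * (1 + t2 ^+ 2) * o2 L).

Local Notation Z := grad2.
Local Notation ric := (ricci_form4 bracket_table).
Local Notation trLZ := (d0 L * d0 Z + d1 L * d1 Z + d2 L * d2 Z
  + (o0 L * o0 Z + o1 L * o1 Z + o2 L * o2 Z) *+ 2).

Ltac table := rewrite /grad2; cbn [d0 d1 d2 o0 o1 o2];
  rewrite /ricci_form4 /sum6 /christoffel2 /bracket_table /eps /entry /slope; ring.

(** The vectors n_i = e_i + t_i f_i are orthogonal to the second factor, so that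
    w |-> q(n_i, w) e_j is an endomorphism A of the first factor that kills the
    second.  Deforming the metric along A only changes L, by
    A L + L A^T - (tr A) L, and the derivative of the scalar curvature along
    this deformation is - 2 Ric(n_i, e_j).  Hence
    4 Ric(n_i, e_j) = tr (L Z) delta_ij - 2 (L Z)_ij for Z = [grad2]; the nine
    lemmas are the entries of this identity. *)
Lemma ricci_mixed00 : ric 0 0 + t0 * ric 3 0 =
  trLZ - (d0 L * d0 Z + o2 L * o2 Z + o1 L * o1 Z) *+ 2.
Proof. table. Qed.

Lemma ricci_mixed01 : ric 0 1 + t0 * ric 3 1 =
  - (d0 L * o2 Z + o2 L * d1 Z + o1 L * o0 Z) *+ 2.
Proof. table. Qed.

Lemma ricci_mixed02 : ric 0 2 + t0 * ric 3 2 =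
  - (d0 L * o1 Z + o2 L * o0 Z + o1 L * d2 Z) *+ 2.
Proof. table. Qed.

Lemma ricci_mixed10 : ric 1 0 + t1 * ric 4 0 =
  - (o2 L * d0 Z + d1 L * o2 Z + o0 L * o1 Z) *+ 2.
Proof. table. Qed.

Lemma ricci_mixed11 : ric 1 1 + t1 * ric 4 1 =
  trLZ - (o2 L * o2 Z + d1 L * d1 Z + o0 L * o0 Z) *+ 2.
Proof. table. Qed.

Lemma ricci_mixed12 : ric 1 2 + t1 * ric 4 2 =
  - (o2 L * o1 Z + d1 L * o0 Z + o0 L * d2 Z) *+ 2.
Proof. table. Qed.

Lemma ricci_mixed20 : ric 2 0 + t2 * ric 5 0 =
  - (o1 L * d0 Z + o0 L * o2 Z + d2 L * o1 Z) *+ 2.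
Proof. table. Qed.

Lemma ricci_mixed21 : ric 2 1 + t2 * ric 5 1 =
  - (o1 L * o2 Z + o0 L * d1 Z + d2 L * o0 Z) *+ 2.
Proof. table. Qed.

Lemma ricci_mixed22 : ric 2 2 + t2 * ric 5 2 =
  trLZ - (o1 L * o1 Z + o0 L * o0 Z + d2 L * d2 Z) *+ 2.
Proof. table. Qed.

Local Notation sq a b l := (bracket_table a b l ^+ 2).
Local Notation sqD a b l := ((bracket_table a b l + bracket_table a l b) ^+ 2).
(** The f_i are horizontal for the submersion onto the quotient by the first
    factor, whose structure matrix is M.  The squares on the left are O'Neill's
    terms: the curvature of the horizontal distribution and the second
    fundamental form of the fibres. *)
Lemma ricci_base : ric 3 3 + ric 4 4 + ric 5 5
  + (sq 3 4 0 + sq 3 4 1 + sq 3 4 2 + sq 4 5 0 + sq 4 5 1 + sq 4 5 2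
     + sq 5 3 0 + sq 5 3 1 + sq 5 3 2) *+ 4
  + (sqD 3 0 1 + sqD 3 0 2 + sqD 3 1 2 + sqD 4 0 1 + sqD 4 0 2 + sqD 4 1 2
     + sqD 5 0 1 + sqD 5 0 2 + sqD 5 1 2) *+ 2
  + (sq 3 0 0 + sq 3 1 1 + sq 3 2 2 + sq 4 0 0 + sq 4 1 1 + sq 4 2 2
     + sq 5 0 0 + sq 5 1 1 + sq 5 2 2) *+ 4 = scal3 M *+ 2.
Proof. rewrite /scal3; table. Qed.

End Table.
End RicciTable.

Section EinsteinTable.
Variable R : realFieldType.

(** The mixed identities say that L Z = 4 lambda, so Z is proportional to the
    adjugate of L; dropping the squares in the base identity leaves the
    inequality. *)
Lemma einstein_table (L M : sym3 R) t0 t1 t2 (lambda : R) :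
  (forall y z, (y < 6)%N -> (z < 6)%N ->
     ricci_form4 (bracket_table L M t0 t1 t2) y z = (y == z)%:R * (4 * lambda)) ->
  let Z := grad2 L M t0 t1 t2 in
  [/\ det3 L * o0 Z = 4 * lambda * o0 (adj3 L),
      det3 L * o1 Z = 4 * lambda * o1 (adj3 L),
      det3 L * o2 Z = 4 * lambda * o2 (adj3 L) &
      6 * lambda <= scal3 M].
Proof.
move=> H; set Z := grad2 L M t0 t1 t2; pose tr := d0 L * d0 Z + d1 L * d1 Z + d2 L * d2 Z
  + (o0 L * o0 Z + o1 L * o1 Z + o2 L * o2 Z) *+ 2.
have m00 := ricci_mixed00 L M t0 t1 t2; have m01 := ricci_mixed01 L M t0 t1 t2.
have m02 := ricci_mixed02 L M t0 t1 t2; have m10 := ricci_mixed10 L M t0 t1 t2.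
have m11 := ricci_mixed11 L M t0 t1 t2; have m12 := ricci_mixed12 L M t0 t1 t2.
have m20 := ricci_mixed20 L M t0 t1 t2; have m21 := ricci_mixed21 L M t0 t1 t2.
have m22 := ricci_mixed22 L M t0 t1 t2; have b := ricci_base L M t0 t1 t2.
rewrite !H // -/Z -/tr in m00 m01 m02 m10 m11 m12 m20 m21 m22 b; clear H.
clearbody Z; rewrite /= in m00 m01 m02 m10 m11 m12 m20 m21 m22 b.
have trE : tr = 12 * lambda.
  have : tr = d0 L * d0 Z + d1 L * d1 Z + d2 L * d2 Z
    + (o0 L * o0 Z + o1 L * o1 Z + o2 L * o2 Z) *+ 2 by [].
  by clearbody tr => trE; lra.
clearbody tr.
split.
- transitivity (o2 (adj3 L) * (d0 L * o1 Z + o2 L * o0 Z + o1 L * d2 Z)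
    + o0 (adj3 L) * (o1 L * o1 Z + o0 L * o0 Z + d2 L * d2 Z)
    + d1 (adj3 L) * (o2 L * o1 Z + d1 L * o0 Z + o0 L * d2 Z)).
    by rewrite /det3 /=; ring.
  have -> : d0 L * o1 Z + o2 L * o0 Z + o1 L * d2 Z = 0 by lra.
  have -> : o2 L * o1 Z + d1 L * o0 Z + o0 L * d2 Z = 0 by lra.
  have -> : o1 L * o1 Z + o0 L * o0 Z + d2 L * d2 Z = 4 * lambda by lra.
  ring.
- transitivity (d0 (adj3 L) * (d0 L * o1 Z + o2 L * o0 Z + o1 L * d2 Z)
    + o1 (adj3 L) * (o1 L * o1 Z + o0 L * o0 Z + d2 L * d2 Z)
    + o2 (adj3 L) * (o2 L * o1 Z + d1 L * o0 Z + o0 L * d2 Z)).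
    by rewrite /det3 /=; ring.
  have -> : d0 L * o1 Z + o2 L * o0 Z + o1 L * d2 Z = 0 by lra.
  have -> : o2 L * o1 Z + d1 L * o0 Z + o0 L * d2 Z = 0 by lra.
  have -> : o1 L * o1 Z + o0 L * o0 Z + d2 L * d2 Z = 4 * lambda by lra.
  ring.
- transitivity (d0 (adj3 L) * (d0 L * o2 Z + o2 L * d1 Z + o1 L * o0 Z)
    + o2 (adj3 L) * (o2 L * o2 Z + d1 L * d1 Z + o0 L * o0 Z)
    + o1 (adj3 L) * (o1 L * o2 Z + o0 L * d1 Z + d2 L * o0 Z)).
    by rewrite /det3 /=; ring.
  have -> : d0 L * o2 Z + o2 L * d1 Z + o1 L * o0 Z = 0 by lra.
  have -> : o1 L * o2 Z + o0 L * d1 Z + d2 L * o0 Z = 0 by lra.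
  have -> : o2 L * o2 Z + d1 L * d1 Z + o0 L * o0 Z = 4 * lambda by lra.
  ring.
- have sum_sqr9 (x0 x1 x2 x3 x4 x5 x6 x7 x8 : R) : 0 <= x0 ^+ 2 + x1 ^+ 2 + x2 ^+ 2
      + x3 ^+ 2 + x4 ^+ 2 + x5 ^+ 2 + x6 ^+ 2 + x7 ^+ 2 + x8 ^+ 2.
    by rewrite !addr_ge0 ?sqr_ge0.
  move: b; set S1 := (X in _ + X *+ 4 + _ *+ 2); set S2 := (X in _ + X *+ 2 + _ *+ 4).
  set S3 := (X in _ + X *+ 4 = _) => b.
  have S1_ge0 : 0 <= S1 by exact: sum_sqr9.
  have S2_ge0 : 0 <= S2 by exact: sum_sqr9.
  have S3_ge0 : 0 <= S3 by exact: sum_sqr9.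
  by lra.
Qed.
End EinsteinTable.

Section Half.
Variable R : realFieldType.
(** Passing from the basis uhat_i to e_i = k_i uhat_i changes the structure
    matrix in this way. *)
Definition rescale (X : sym3 R) k0 k1 k2 := Sym3
  (k1 * k2 / k0 * d0 X) (k2 * k0 / k1 * d1 X) (k0 * k1 / k2 * d2 X)
  (k0 * o0 X) (k1 * o1 X) (k2 * o2 X).

(** In terms of X the terms with t_i^2 combine into h - 1 or h + 1, because
    (t_i / k_i)^2 = k_i^-2 - 1, and the dependence on k_i is left only in h. *)
Lemma einstein_rescaled (X M : sym3 R) k0 k1 k2 t0 t1 t2 (lambda : R) :
  k0 != 0 -> k1 != 0 -> k2 != 0 ->
  k0 ^+ 2 = 1 - t0 ^+ 2 -> k1 ^+ 2 = 1 - t1 ^+ 2 -> k2 ^+ 2 = 1 - t2 ^+ 2 ->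
  (forall y z, (y < 6)%N -> (z < 6)%N ->
     ricci_form4 (bracket_table (rescale X k0 k1 k2) M (t0 / k0) (t1 / k1) (t2 / k2)) y z
     = (y == z)%:R * (4 * lambda)) ->
  let h (k k' : R) := (k ^- 2 + k' ^- 2) / 2 in
  [/\ det3 X * ((1 + h k1 k2) * o0 X - t0 * (h k1 k2 - 1) * o0 M)
        = - (2 * lambda) * o0 (adj3 X),
      det3 X * ((1 + h k2 k0) * o1 X - t1 * (h k2 k0 - 1) * o1 M)
        = - (2 * lambda) * o1 (adj3 X),
      det3 X * ((1 + h k0 k1) * o2 X - t2 * (h k0 k1 - 1) * o2 M)
        = - (2 * lambda) * o2 (adj3 X) &
      3 * (2 * lambda) <= scal3 M].
Proof.
move=> k0n k1n k2n kt0 kt1 kt2 H h.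
have tE (k t : R) : k != 0 -> k ^+ 2 = 1 - t ^+ 2 -> (t / k) ^+ 2 = k ^- 2 - 1.
  move=> kn kt; rewrite expr_div_n; apply: (mulIf (expf_neq0 2 kn)).
  by rewrite divfK ?expf_neq0 // mulrBl mulVf ?expf_neq0 // mul1r kt; ring.
have [Z0 Z1 Z2 S] := einstein_table H.
have DL : det3 (rescale X k0 k1 k2) = k0 * k1 * k2 * det3 X.
  by rewrite /det3 /=; field; rewrite ?k0n ?k1n ?k2n.
rewrite DL in Z0 Z1 Z2.
move: Z0 Z1 Z2; rewrite /grad2; cbn [d0 d1 d2 o0 o1 o2 rescale].
rewrite (tE _ _ k0n kt0) (tE _ _ k1n kt1) (tE _ _ k2n kt2) => Z0 Z1 Z2.
split; last by lra.
- have kk : 2 * k1 * k2 != 0 by rewrite !mulf_neq0 // pnatr_eq0.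
  apply: (mulfI kk); rewrite mulNr mulrN.
  have -> : 2 * k1 * k2 * (2 * lambda * o0 (adj3 X)) =
    4 * lambda * o0 (adj3 (rescale X k0 k1 k2)) by rewrite /=; field; rewrite ?k0n ?k1n ?k2n.
  by rewrite /= -Z0 /h; field; rewrite ?k0n ?k1n ?k2n.
- have kk : 2 * k2 * k0 != 0 by rewrite !mulf_neq0 // pnatr_eq0.
  apply: (mulfI kk); rewrite mulNr mulrN.
  have -> : 2 * k2 * k0 * (2 * lambda * o1 (adj3 X)) =
    4 * lambda * o1 (adj3 (rescale X k0 k1 k2)) by rewrite /=; field; rewrite ?k0n ?k1n ?k2n.
  by rewrite /= -Z1 /h; field; rewrite ?k0n ?k1n ?k2n.
- have kk : 2 * k0 * k1 != 0 by rewrite !mulf_neq0 // pnatr_eq0.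
  apply: (mulfI kk); rewrite mulNr mulrN.
  have -> : 2 * k0 * k1 * (2 * lambda * o2 (adj3 X)) =
    4 * lambda * o2 (adj3 (rescale X k0 k1 k2)) by rewrite /=; field; rewrite ?k0n ?k1n ?k2n.
  by rewrite /= -Z2 /h; field; rewrite ?k0n ?k1n ?k2n.
Qed.
End Half.

(** * Vector algebra in dimension three *)

(** Literal indices, for which the entries of [vec3] are found by computation. *)
Definition i0 : 'I_3 := @Ordinal 3 0 isT.
Definition i1 : 'I_3 := @Ordinal 3 1 isT.
Definition i2 : 'I_3 := @Ordinal 3 2 isT.

Section Cross.
Variable R : realFieldType.
Implicit Types u v w x y z : 'rV[R]_3.

Definition vec3 (a b c : R) : 'rV[R]_3 := \row_i [:: a; b; c]`_i.
Definition cross u v := vec3 (u 0 i1 * v 0 i2 - u 0 i2 * v 0 i1)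
  (u 0 i2 * v 0 i0 - u 0 i0 * v 0 i2) (u 0 i0 * v 0 i1 - u 0 i1 * v 0 i0).
Definition dot u v := u 0 i0 * v 0 i0 + u 0 i1 * v 0 i1 + u 0 i2 * v 0 i2.
Definition triple u v w := dot u (cross v w).

Lemma row3P u v : u 0 i0 = v 0 i0 -> u 0 i1 = v 0 i1 -> u 0 i2 = v 0 i2 -> u = v.
Proof.
move=> e0 e1 e2; apply/rowP => -[[|[|[|//]]] lt3].
- by rewrite (_ : Ordinal lt3 = i0) //; apply: val_inj.
- by rewrite (_ : Ordinal lt3 = i1) //; apply: val_inj.
- by rewrite (_ : Ordinal lt3 = i2) //; apply: val_inj.
Qed.

Lemma vec3E a b c : (vec3 a b c 0 i0 = a) * (vec3 a b c 0 i1 = b) * (vec3 a b c 0 i2 = c).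
Proof. by rewrite !mxE. Qed.

Lemma cross_linl a u v w : cross (a *: u + v) w = a *: cross u w + cross v w.
Proof. by apply: row3P; rewrite /cross !mxE /=; ring. Qed.
Lemma cross_linr a u v w : cross w (a *: u + v) = a *: cross w u + cross w v.
Proof. by apply: row3P; rewrite /cross !mxE /=; ring. Qed.
Lemma crossC u v : cross u v = - cross v u.
Proof. by apply: row3P; rewrite /cross !mxE /=; ring. Qed.

Lemma dot_ge0 u : 0 <= dot u u.
Proof. by rewrite /dot -!expr2 !addr_ge0 ?sqr_ge0. Qed.

Lemma dot_eq0 u : dot u u = 0 -> u = 0.
Proof.
rewrite /dot -!expr2 => e.
have := sqr_ge0 (u 0 i0); have := sqr_ge0 (u 0 i1); have := sqr_ge0 (u 0 i2).
move=> p2 p1 p0.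
have Z (x : R) : x ^+ 2 = 0 -> x = 0 by move/eqP; rewrite sqrf_eq0 => /eqP.
by apply: row3P; rewrite [RHS]mxE; apply: Z; lra.
Qed.

Lemma dotC u v : dot u v = dot v u.
Proof. by rewrite /dot; ring. Qed.

(** Cramer's rule in vector form. *)
Lemma frame_decomposition u v w x : triple u v w *: x =
  dot (cross v w) x *: u + dot (cross w u) x *: v + dot (cross u v) x *: w.
Proof. by apply: row3P; rewrite /triple /dot /cross !mxE /=; ring. Qed.

(** If the triple product vanishes, [frame_decomposition] is a linear relation;
    it forces v x w = 0, and then the expansion of v x (v x w) is a relation
    between v and w. *)
Lemma triple_neq0 u v w :
  (forall a b c, a *: u + b *: v + c *: w = 0 -> [/\ a = 0, b = 0 & c = 0]) ->
  triple u v w != 0.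
Proof.
move=> free; apply/eqP => d0.
have /free[/dot_eq0 vw0 _ _] : dot (cross v w) (cross v w) *: u +
    dot (cross w u) (cross v w) *: v + dot (cross u v) (cross v w) *: w = 0.
  by rewrite -frame_decomposition d0 scale0r.
have /free[_ _ /eqP] : 0 *: u + dot v w *: v + (- dot v v) *: w = 0.
  transitivity (cross v (cross v w)).
    by apply: row3P; rewrite /dot /cross !mxE /=; ring.
  by rewrite vw0; apply: row3P; rewrite /cross !mxE /=; ring.
rewrite oppr_eq0 => /eqP/dot_eq0 v0.
have /free[_ /eqP] : 0 *: u + 1 *: v + 0 *: w = 0 by rewrite v0 scaler0 !scale0r !addr0.
by rewrite oner_eq0.
Qed.

Definition gram3 u v w := Sym3 (dot u u) (dot v v) (dot w w) (dot v w) (dot w u) (dot u v).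

Definition scale3 (a : R) (A : sym3 R) :=
  Sym3 (a * d0 A) (a * d1 A) (a * d2 A) (a * o0 A) (a * o1 A) (a * o2 A).

(** The matrix of the cross products v x w, w x u, u x v in the basis u, v, w. *)
Definition structure3 u v w :=
  scale3 (triple u v w)^-1 (gram3 (cross v w) (cross w u) (cross u v)).

Section Frame.
Variables u v w : 'rV[R]_3.
Hypothesis d_neq0 : triple u v w != 0.
Let X := structure3 u v w.

Lemma frame_decompositionV x : x = (dot (cross v w) x / triple u v w) *: u +
  (dot (cross w u) x / triple u v w) *: v + (dot (cross u v) x / triple u v w) *: w.
Proof.
apply: (scalerI d_neq0); rewrite frame_decomposition !scalerDr !scalerA.
by rewrite ![_ * (_ / _)]mulrC !divfK.
Qed.

(** Expanding each cross product by Cramer's rule gives dot products of two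
    cross products, hence a symmetric matrix. *)
Lemma structure_cross : [/\ cross v w = d0 X *: u + o2 X *: v + o1 X *: w,
  cross w u = o2 X *: u + d1 X *: v + o0 X *: w &
  cross u v = o1 X *: u + o0 X *: v + d2 X *: w].
Proof.
split; rewrite [LHS]frame_decompositionV /X /= ![_^-1 * _]mulrC.
- by rewrite (dotC (cross w u)).
- by rewrite (dotC (cross u v)).
- by rewrite (dotC (cross v w)).
Qed.

Lemma det_gram_cross : det3 (gram3 (cross v w) (cross w u) (cross u v)) = triple u v w ^+ 4.
Proof.
rewrite /det3 /gram3; cbn [d0 d1 d2 o0 o1 o2].
by rewrite /triple /dot /cross !mxE /=; ring.
Qed.

Lemma adj_gram_cross : adj3 (gram3 (cross v w) (cross w u) (cross u v)) =
  scale3 (triple u v w ^+ 2) (gram3 u v w).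
Proof.
rewrite /adj3 /scale3 /gram3; cbn [d0 d1 d2 o0 o1 o2].
by congr Sym3; rewrite /triple /dot /cross !mxE /=; ring.
Qed.

Lemma det_scale3 a A : det3 (scale3 a A) = a ^+ 3 * det3 A.
Proof. by rewrite /det3 /=; ring. Qed.

Lemma adj_scale3 a A : adj3 (scale3 a A) = scale3 (a ^+ 2) (adj3 A).
Proof. by rewrite /adj3 /scale3 /=; congr Sym3; ring. Qed.

Lemma structure_det : det3 X = triple u v w.
Proof. by rewrite det_scale3 det_gram_cross; field. Qed.

(** The second cofactors of a basis return the basis up to its determinant:
    (w x u) x (u x v) is the triple product times u.  This links the
    structure constants to the angles between u, v and w. *)
Lemma structure_adj : adj3 X = gram3 u v w.
Proof.
rewrite adj_scale3 adj_gram_cross /scale3 /=.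
have K (x : R) : (triple u v w)^-1 ^+ 2 * (triple u v w ^+ 2 * x) = x by field.
by rewrite !K.
Qed.

Lemma gram_psd p : 0 <= quad3 (gram3 u v w) p.
Proof.
case: p => [[a b] c]; have := dot_ge0 (a *: u + b *: v + c *: w).
congr (_ <= _); rewrite /quad3 /gram3; cbn [d0 d1 d2 o0 o1 o2].
by rewrite /dot !mxE; ring.
Qed.
End Frame.
End Cross.

(** * Principal bases of the two factors *)

Section PrincipalBases.
Variable R : rcfType.
Local Notation W := ('rV[R]_3 * 'rV[R]_3)%type.
Variable q : W -> W -> R.
Hypothesis q_lin : forall a u v w, q (a *: u + v) w = a * q u w + q v w.
Hypothesis q_sym : forall u v, q u v = q v u.
Hypothesis q_pos : forall u, u != 0 -> 0 < q u u.

Lemma bilinear_matrix n m (b : 'rV[R]_n -> 'rV[R]_m -> R) :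
  (forall a x y z, b (a *: x + y) z = a * b x z + b y z) ->
  (forall a x y z, b z (a *: x + y) = a * b z x + b z y) ->
  forall x y, b x y = (x *m (\matrix_(i, j) b (delta_mx 0 i) (delta_mx 0 j)) *m y^T) 0 0.
Proof.
move=> b_linl b_linr x y.
have lin_sum k (f : 'rV[R]_k -> R) : (forall a x y, f (a *: x + y) = a * f x + f y) ->
    forall x, f x = \sum_i x 0 i * f (delta_mx 0 i).
  move=> fl z; have f0 : f 0 = 0 by have := fl (-1) 0 0; rewrite scaler0 addr0 mulN1r addNr.
  have fD s t : f (s + t) = f s + f t by rewrite -{1}[s]scale1r fl mul1r.
  rewrite {1}[z]row_sum_delta (big_morph f fD f0); apply: eq_bigr => i _.
  by rewrite -[_ *: _]addr0 fl f0 addr0.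
rewrite (lin_sum _ (fun x => b x y)) // -mulmxA mxE; apply: eq_bigr => i _; congr (_ * _).
rewrite mxE (lin_sum _ (b (delta_mx 0 i))) //; apply: eq_bigr => j _.
by rewrite !mxE mulrC.
Qed.

(** Cholesky factors make q the standard form on each factor; a singular value
    decomposition of the cross block then leaves both standard and makes that
    block diagonal. *)
Lemma principal_bases : exists (u v : nat -> 'rV[R]_3) (t : nat -> R),
  forall i j, (i < 3)%N -> (j < 3)%N ->
  [/\ q (u i, 0) (u j, 0) = (i == j)%:R, q (0, v i) (0, v j) = (i == j)%:R &
      q (u i, 0) (0, v j) = - t i * (i == j)%:R].
Proof.
have q_linr a x y z : q z (a *: x + y) = a * q z x + q z y.
  by rewrite q_sym q_lin ![q _ z]q_sym.
have inj1 a (x y : 'rV[R]_3) : (a *: x + y, 0) = a *: (x, 0) + (y, 0) :> W.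
  by congr pair; rewrite /= scaler0 addr0.
have inj2 a (x y : 'rV[R]_3) : (0, a *: x + y) = a *: (0, x) + (0, y) :> W.
  by congr pair; rewrite /= scaler0 addr0.
pose b1 x y := q (x, 0) (y, 0); pose b2 x y := q (0, x) (0, y).
pose b3 x y := q (x, 0) (0, y).
pose gram (b : 'rV[R]_3 -> 'rV[R]_3 -> R) := \matrix_(i, j) b (delta_mx 0 i) (delta_mx 0 j).
pose P1 := gram b1; pose P2 := gram b2; pose P3 := gram b3.
have B1 x y : b1 x y = (x *m P1 *m y^T) 0 0.
  by apply: bilinear_matrix => *; rewrite /b1 inj1 ?q_lin ?q_linr.
have B2 x y : b2 x y = (x *m P2 *m y^T) 0 0.
  by apply: bilinear_matrix => *; rewrite /b2 inj2 ?q_lin ?q_linr.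
have B3 x y : b3 x y = (x *m P3 *m y^T) 0 0.
  by apply: bilinear_matrix => *; rewrite /b3 ?inj1 ?inj2 ?q_lin ?q_linr.
have [|v v0|U UU] := @cholesky R 3 P1.
- by apply/matrixP => i j; rewrite !mxE /b1 q_sym.
- by rewrite -B1 q_pos // xpair_eqE negb_and v0.
have [|v v0|V VV] := @cholesky R 3 P2.
- by apply/matrixP => i j; rewrite !mxE /b2 q_sym.
- by rewrite -B2 q_pos // xpair_eqE negb_and v0 orbT.
have [H [K [HH KK D]]] := svd (U *m P3 *m V^T).
move: D; set S := H *m _ *m _ => D.
have entry (A B P : 'M[R]_3) i j : (row i A *m P *m (row j B)^T) 0 0 = (A *m P *m B^T) i j.
  by rewrite -row_mul tr_row mxE [RHS]mxE; apply: eq_bigr => k _; rewrite mxE [X in _ * X]mxE.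
exists (fun n => row (inord n) (H *m U)), (fun n => row (inord n) (K *m V)),
  (fun n => - S (inord n) (inord n)).
move=> i j li lj; have ijE : (inord i == inord j :> 'I_3) = (i == j).
  by rewrite -val_eqE /= !inordK.
rewrite -/(b1 _ _) -/(b2 _ _) -/(b3 _ _) B1 B2 B3 !entry !trmx_mul.
have E (X Y Z T P : 'M[R]_3) : X *m Y *m P *m (T *m Z) = X *m (Y *m P *m T) *m Z.
  by rewrite !mulmxA.
rewrite !E UU VV !mulmx1 HH KK -/S opprK; clearbody S; rewrite !mxE ijE; split=> //.
have [ij|ij] := eqVneq i j; first by rewrite -ij mulr1.
by rewrite mulr0; apply: (is_diag_mxP D); rewrite !inordK.
Qed.
End PrincipalBases.

(** * The adapted orthonormal frame *)

Section Frame.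
Variable R : realFieldType.
Implicit Types (k t : nat -> R) (X M : sym3 R).

Definition frame_index (a : nat) := match a with S (S (S i)) => i | _ => a end.
Definition coefu k t (a : nat) := match a with S (S (S i)) => t i | _ => k a end.
Definition coefv (a : nat) : R := match a with S (S (S _)) => 1 | _ => 0 end.
(** The product of a vector with the d-th vector of the adapted frame, where x
    and y are the coordinates of that vector on uhat and vhat at the index of d. *)
Definition adapted_coord k t (d : nat) (x y : R) :=
  match d with S (S (S _)) => y | _ => x / k d - t d / k d * y end.

(** The left-hand side is the bracket of two adapted vectors computed from the
    structure matrices of uhat and vhat. *)
Lemma bracket_tableE k t X M a b d : k 0 != 0 -> k 1 != 0 -> k 2 != 0 ->
  (a < 6)%N -> (b < 6)%N -> (d < 6)%N ->
  adapted_coord k t d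
    (coefu k t a * coefu k t b *
       eps (frame_index a) (frame_index b) (fun c => entry X c (frame_index d)))
    (coefv a * coefv b *
       eps (frame_index a) (frame_index b) (fun c => entry M c (frame_index d))) =
  bracket_table (rescale X (k 0) (k 1) (k 2)) M (t 0 / k 0) (t 1 / k 1) (t 2 / k 2) a b d.
Proof.
move=> k0 k1 k2.
case: a => [|[|[|[|[|[|//]]]]]] _; case: b => [|[|[|[|[|[|//]]]]]] _;
  case: d => [|[|[|[|[|[|//]]]]]] _;
  rewrite /bracket_table /adapted_coord /coefu /coefv /frame_index /eps /entry /slope;
  rewrite /rescale; cbn [d0 d1 d2 o0 o1 o2];
  try (by field; rewrite ?k0 ?k1 ?k2).
Qed.
End Frame.

Section Core.
Variable R : rcfType.
Local Notation W := ('rV[R]_3 * 'rV[R]_3)%type.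

Definition bracket (x y : W) : W := (cross x.1 y.1, cross x.2 y.2).

Lemma bracket_linl a x y z : bracket (a *: x + y) z = a *: bracket x z + bracket y z.
Proof. by rewrite /bracket /= !cross_linl. Qed.
Lemma bracket_linr a x y z : bracket z (a *: x + y) = a *: bracket z x + bracket z y.
Proof. by rewrite /bracket /= !cross_linr. Qed.

Record inner (q : W -> W -> R) : Prop := Inner {
  inner_lin : forall a u v w, q (a *: u + v) w = a * q u w + q v w;
  inner_sym : forall u v, q u v = q v u;
  inner_pos : forall u, u != 0 -> 0 < q u u }.

(** The Einstein equation of a left-invariant metric, read on the Lie algebra:
    [N A B] is the covariant derivative of left-invariant fields. *)
Definition einstein_inner (q : W -> W -> R) (lambda : R) := exists2 N : W -> W -> W,
  forall A B C, 2 * q (N A B) C = koszul bracket q A B C &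
  forall E : 'I_6 -> W, (forall i j, q (E i) (E j) = (i == j)%:R) ->
    forall Y Z, \sum_(a < 6) q (N (E a) (N Y Z) - N Y (N (E a) Z) - N (bracket (E a) Y) Z) (E a)
      = lambda * q Y Z.

(** With this sign, vhat_i becomes orthogonal to the first factor when t_i uhat_i
    is added to it. *)
Definition principal_pair (q : W -> W -> R) (u v : nat -> 'rV[R]_3) (t : nat -> R) :=
  forall i j, (i < 3)%N -> (j < 3)%N ->
  [/\ q (u i, 0) (u j, 0) = (i == j)%:R, q (0, v i) (0, v j) = (i == j)%:R &
      q (u i, 0) (0, v j) = - t i * (i == j)%:R].

Definition swap_factors (x : W) : W := (x.2, x.1).
Definition swap_inner (q : W -> W -> R) x y := q (swap_factors x) (swap_factors y).

Lemma inner_swap q : inner q -> inner (swap_inner q).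
Proof.
move=> [l s p]; split=> [a u v w|u v|u u0]; rewrite /swap_inner.
- by rewrite -l.
- exact: s.
- by apply: p; apply: contra_neq u0; case: u => u1 u2 [-> ->].
Qed.

(** Exchanging the two factors is an automorphism of the bracket. *)
Lemma einstein_swap q lambda : einstein_inner q lambda -> einstein_inner (swap_inner q) lambda.
Proof.
have bracketS x y : bracket (swap_factors x) (swap_factors y) = swap_factors (bracket x y) by [].
have sK : involutive swap_factors by case.
move=> [N NE ein]; exists (fun A B => swap_factors (N (swap_factors A) (swap_factors B))).
  by move=> A B C; rewrite /koszul /swap_inner -!bracketS -/(koszul bracket q _ _ _) -NE sK.
move=> E orth Y Z; rewrite /swap_inner -(ein (fun i => swap_factors (E i))) //.
by apply: eq_bigr => a _; rewrite -!bracketS !sK.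
Qed.

Lemma principal_swap q u v t : inner q ->
  principal_pair q u v t -> principal_pair (swap_inner q) v u t.
Proof.
move=> qi P i j li lj; have [a b c] := P i j li lj; split=> //.
rewrite /swap_inner /swap_factors /= (inner_sym qi); have [_ _ ->] := P j i lj li.
by rewrite eq_sym; case: eqP => [->|] //; rewrite !mulr0.
Qed.

Section PrincipalFrame.
Variables (q : W -> W -> R) (u v : nat -> 'rV[R]_3) (t : nat -> R) (lambda : R).
Hypothesis qi : inner q.
Hypothesis P : principal_pair q u v t.
Let q_lin := inner_lin qi.
Let q_sym := inner_sym qi.

Lemma inner_linr a x y z : q z (a *: x + y) = a * q z x + q z y.
Proof. by rewrite q_sym q_lin ![q _ z]q_sym. Qed.
Lemma inner0 x : q 0 x = 0.
Proof. by have := q_lin (-1) 0 0 x; rewrite scaler0 addr0 mulN1r addNr. Qed.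
Lemma innerZ a x z : q (a *: x) z = a * q x z.
Proof. by rewrite -[_ *: _]addr0 q_lin inner0 addr0. Qed.

(** The cosine of the angle between u_n and v_n is - t_n. *)
Definition sin_angle n := Num.sqrt (1 - t n ^+ 2).
Local Notation k := sin_angle.
Definition uhat n := (k n)^-1 *: u n.
Definition vhat n := (k n)^-1 *: v n.

(** Strict Cauchy-Schwarz for u_n and v_n, which lie in different factors. *)
Lemma sin_sqr_gt0 n : (n < 3)%N -> 0 < 1 - t n ^+ 2.
Proof.
move=> ln; have [uu vv uv] := P ln ln.
rewrite eqxx /= ?mulr1 in uu vv uv.
have w0 : t n *: (0, v n) + (u n, 0) != 0 :> W.
  apply/eqP => -[/eqP]; rewrite scaler0 add0r => /eqP u0 _.
  by move: uu; rewrite u0 inner0 => /esym/eqP; rewrite oner_eq0.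
have := inner_pos qi w0; rewrite q_lin !inner_linr vv uu uv [q (0, _) (u n, _)]q_sym uv.
by congr (_ < _); ring.
Qed.

Lemma sin_angle_neq0 n : (n < 3)%N -> k n != 0.
Proof. by move=> ln; rewrite gt_eqF // sqrtr_gt0 sin_sqr_gt0. Qed.

Lemma sin_angle_sqr n : (n < 3)%N -> k n ^+ 2 = 1 - t n ^+ 2.
Proof. by move=> ln; rewrite sqr_sqrtr // ltW // sin_sqr_gt0. Qed.

Lemma u_uhat n : (n < 3)%N -> u n = k n *: uhat n.
Proof. by move=> ln; rewrite scalerA divff ?sin_angle_neq0 // scale1r. Qed.

(** The second half consists of the vectors v_n made orthogonal to the first
    factor and normalised. *)
Definition adapted n : W :=
  match n with S (S (S i)) => (t i *: uhat i, vhat i) | _ => (u n, 0) end.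

Lemma adaptedE a : (a < 6)%N ->
  adapted a = (coefu k t a *: uhat (frame_index a), coefv R a *: vhat (frame_index a)).
Proof.
by case: a => [|[|[|a]]] la; rewrite /= ?scale0r ?scale1r // ?u_uhat.
Qed.

Lemma uhat_adapted l d : (l < 3)%N -> (d < 6)%N ->
  q (uhat l, 0) (adapted d) = adapted_coord k t d (l == frame_index d)%:R 0.
Proof.
move=> ll ld; have pairZ a (x : 'rV[R]_3) : (a *: x, 0) = a *: (x, 0) :> W.
  by congr pair; rewrite /= scaler0.
have pairZ2 a (x : 'rV[R]_3) : (0, a *: x) = a *: (0, x) :> W.
  by congr pair; rewrite /= scaler0.
rewrite /uhat pairZ innerZ.
have lt3 i : (i.+3 < 6)%N -> (i < 3)%N by [].
have [ld3|ld3] := ltnP d 3.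
  have -> : adapted d = (u d, 0) by case: d ld ld3 => [|[|[|]]].
  have [-> _ _] := P ll ld3.
  have -> : frame_index d = d by case: d ld ld3 => [|[|[|]]].
  have -> : forall x y, adapted_coord k t d x y = x / k d - t d / k d * y.
    by case: d ld ld3 => [|[|[|]]].
  by have [->|_] := eqVneq l d; rewrite ?mulr0 ?subr0 ?mul0r // mulrC.
case: d ld ld3 => [|[|[|d]]] // ld _; have {}ld := lt3 _ ld.
have [uu _ uv] := P ll ld.
have -> : adapted d.+3 = t d *: ((k d)^-1 *: (u d, 0)) + (k d)^-1 *: (0, v d).
  by congr pair; rewrite /= !(scaler0, addr0, add0r).
rewrite inner_linr !(q_sym (u l, 0)) !innerZ q_sym uu q_sym uv /=.
by have [->|_] := eqVneq l d; rewrite ?mulr1 ?mulr0; ring.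
Qed.

Lemma vhat_adapted l d : (l < 3)%N -> (d < 6)%N ->
  q (0, vhat l) (adapted d) = adapted_coord k t d 0 (l == frame_index d)%:R.
Proof.
move=> ll ld.
have pairZ2 a (x : 'rV[R]_3) : (0, a *: x) = a *: (0, x) :> W.
  by congr pair; rewrite /= scaler0.
rewrite /vhat pairZ2 innerZ.
have lt3 i : (i.+3 < 6)%N -> (i < 3)%N by [].
have [ld3|ld3] := ltnP d 3.
  have -> : adapted d = (u d, 0) by case: d ld ld3 => [|[|[|]]].
  have [_ _ uv] := P ld3 ll; rewrite q_sym uv {uv}.
  have -> : frame_index d = d by case: d ld ld3 => [|[|[|]]].
  have -> : forall x y, adapted_coord k t d x y = x / k d - t d / k d * y.
    by case: d ld ld3 => [|[|[|]]].
  by rewrite eq_sym; have [->|_] := eqVneq l d; rewrite ?mulr1 ?mulr0 ?mul0r; ring.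
case: d ld ld3 => [|[|[|d]]] // ld _; have {}ld := lt3 _ ld.
have [_ vv _] := P ll ld; have [_ _ uv] := P ld ll; rewrite eq_sym in uv.
have -> : adapted d.+3 = t d *: ((k d)^-1 *: (u d, 0)) + (k d)^-1 *: (0, v d).
  by congr pair; rewrite /= !(scaler0, addr0, add0r).
rewrite inner_linr !(q_sym (0, v l)) !innerZ uv q_sym vv /=.
have [ld'|_] := eqVneq l d; last by rewrite /= !mulr0; ring.
rewrite ld' /= !mulr1; have kd := sin_angle_neq0 ld.
apply: (mulIf (expf_neq0 2 kd)); rewrite mul1r {2}(sin_angle_sqr ld).
by field.
Qed.

Definition comb (x y : nat -> R) : W :=
  x 0 *: (uhat 0, 0) + (x 1 *: (uhat 1, 0) + (x 2 *: (uhat 2, 0) +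
  (y 0 *: (0, vhat 0) + (y 1 *: (0, vhat 1) + y 2 *: (0, vhat 2))))).

Lemma combE x y : comb x y = (x 0 *: uhat 0 + x 1 *: uhat 1 + x 2 *: uhat 2,
                              y 0 *: vhat 0 + y 1 *: vhat 1 + y 2 *: vhat 2).
Proof. by congr pair; rewrite /= !scaler0 !(addr0, add0r) !addrA. Qed.

Lemma comb_adapted x y d : (d < 6)%N ->
  q (comb x y) (adapted d) = adapted_coord k t d (x (frame_index d)) (y (frame_index d)).
Proof.
move=> ld; rewrite /comb !q_lin innerZ !uhat_adapted // !vhat_adapted //.
by case: d ld => [|[|[|[|[|[|//]]]]]] _ /=; ring.
Qed.

Lemma adapted_comb a : (a < 6)%N -> adapted a =
  comb (fun l => coefu k t a * (l == frame_index a)%:R)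
       (fun l => coefv R a * (l == frame_index a)%:R).
Proof.
move=> la; rewrite adaptedE // combE.
by case: a la => [|[|[|[|[|[|//]]]]]] _ /=; rewrite !(mulr0, mulr1) !scale0r ?(addr0, add0r).
Qed.

Lemma adapted_orthonormal a b : (a < 6)%N -> (b < 6)%N ->
  q (adapted a) (adapted b) = (a == b)%:R.
Proof.
move=> la lb; rewrite adapted_comb // comb_adapted //.
have k0 := @sin_angle_neq0 0 isT; have k1 := @sin_angle_neq0 1 isT.
have k2 := @sin_angle_neq0 2 isT.
by case: a la => [|[|[|[|[|[|//]]]]]] _; case: b lb => [|[|[|[|[|[|//]]]]]] _;
  rewrite /=; field; rewrite ?k0 ?k1 ?k2.
Qed.

Lemma triple_uhat : triple (uhat 0) (uhat 1) (uhat 2) != 0.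
Proof.
apply: triple_neq0 => a b c abc.
pose x n := match n with 0 => a | 1 => b | _ => c end.
have H d : (d < 3)%N -> x d = 0.
  move=> ld; have : q (comb x (fun _ => 0)) (adapted d) = 0.
    by rewrite combE /= abc !scale0r !addr0 inner0.
  rewrite comb_adapted; last exact: ltn_trans ld _.
  have kd := sin_angle_neq0 ld.
  case: d ld kd => [|[|[|//]]] _ kd /=; rewrite mulr0 subr0 => /eqP;
    by rewrite mulf_eq0 invr_eq0 (negPf kd) orbF => /eqP.
by split; [exact: (H 0%N) | exact: (H 1%N) | exact: (H 2%N)].
Qed.

Lemma triple_vhat : triple (vhat 0) (vhat 1) (vhat 2) != 0.
Proof.
apply: triple_neq0 => a b c abc.
pose x n := match n with 0 => a | 1 => b | _ => c end.
have H d : (d < 3)%N -> x d = 0.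
  move=> ld; have : q (comb (fun _ => 0) x) (adapted d.+3) = 0.
    by rewrite combE /= abc !scale0r !addr0 inner0.
  by rewrite comb_adapted.
by split; [exact: (H 0%N) | exact: (H 1%N) | exact: (H 2%N)].
Qed.

Definition structX := structure3 (uhat 0) (uhat 1) (uhat 2).
Definition structM := structure3 (vhat 0) (vhat 1) (vhat 2).

Lemma cross_eps (w : nat -> 'rV[R]_3) (X := structure3 (w 0%N) (w 1%N) (w 2%N)) i j :
  triple (w 0%N) (w 1%N) (w 2%N) != 0 -> (i < 3)%N -> (j < 3)%N ->
  cross (w i) (w j) = eps i j (fun c => entry X c 0) *: w 0%N
    + eps i j (fun c => entry X c 1) *: w 1%N + eps i j (fun c => entry X c 2) *: w 2%N.
Proof.
move=> d0; have [c0 c1 c2] := structure_cross d0; rewrite -/X in c0 c1 c2; clearbody X.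
have self x : cross x x = 0 by apply: row3P; rewrite /cross !mxE /=; ring.
have n0 : cross (w 2%N) (w 1%N) = - cross (w 1%N) (w 2%N) by exact: crossC.
have n1 : cross (w 0%N) (w 2%N) = - cross (w 2%N) (w 0%N) by exact: crossC.
have n2 : cross (w 1%N) (w 0%N) = - cross (w 0%N) (w 1%N) by exact: crossC.
case: i => [|[|[|//]]] _; case: j => [|[|[|//]]] _ /=; rewrite ?self ?n0 ?n1 ?n2 ?c0 ?c1 ?c2;
  rewrite ?scale0r ?addr0 ?scaleNr ?opprD ?oppr0 //.
Qed.

Lemma bracket_adapted a b d : (a < 6)%N -> (b < 6)%N -> (d < 6)%N ->
  q (bracket (adapted a) (adapted b)) (adapted d) =
  bracket_table (rescale structX (k 0) (k 1) (k 2)) structM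
     (t 0 / k 0) (t 1 / k 1) (t 2 / k 2) a b d.
Proof.
move=> la lb ld; have l3 i : (i < 6)%N -> (frame_index i < 3)%N.
  by case: i => [|[|[|[|[|[|//]]]]]].
rewrite -bracket_tableE ?sin_angle_neq0 //; set i := frame_index a; set j := frame_index b.
have crossZ x y (p r : 'rV[R]_3) : cross (x *: p) (y *: r) = (x * y) *: cross p r.
  by apply: row3P; rewrite /cross !mxE /=; ring.
have -> : bracket (adapted a) (adapted b) = comb
   (fun l => coefu k t a * coefu k t b * eps i j (fun c => entry structX c l))
   (fun l => coefv R a * coefv R b * eps i j (fun c => entry structM c l)).
  rewrite combE !adaptedE // /bracket /= -/i -/j.
  rewrite (crossZ _ _ (uhat i) (uhat j)) (crossZ _ _ (vhat i) (vhat j)).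
  rewrite (@cross_eps uhat i j triple_uhat) ?l3 // (@cross_eps vhat i j triple_vhat) ?l3 //.
  by rewrite !scalerDr !scalerA.
by rewrite comb_adapted.
Qed.

Lemma comb_surj w : exists x y, w = comb x y.
Proof.
case: w => w1 w2; set f := frame_decompositionV triple_uhat w1.
set g := frame_decompositionV triple_vhat w2; rewrite f g.
eexists (fun n => match n with 0 => _ | 1 => _ | _ => _ end),
        (fun n => match n with 0 => _ | 1 => _ | _ => _ end); rewrite combE; reflexivity.
Qed.

Lemma adapted_complete w : w = \sum_(d < 6) q w (adapted d) *: adapted d.
Proof.
have [x [y ->]] := comb_surj w.
rewrite (eq_bigr (fun d : 'I_6 =>
  adapted_coord k t d (x (frame_index d)) (y (frame_index d)) *: adapted d));
  last by move=> d _; rewrite comb_adapted.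
have k0 := @sin_angle_neq0 0 isT; have k1 := @sin_angle_neq0 1 isT.
have k2 := @sin_angle_neq0 2 isT.
rewrite !big_ord_recl big_ord0 combE /=.
rewrite (@u_uhat 0) // (@u_uhat 1) // (@u_uhat 2) //.
by congr pair; apply: row3P; rewrite !mxE /=; field; rewrite ?k0 ?k1 ?k2.
Qed.

(** Only one factor is treated; the equations with the factors exchanged come
    from [einstein_swap]. *)
Lemma frame_equations :
  einstein_inner q lambda ->
  let h i j := (k i ^- 2 + k j ^- 2) / 2 in
  [/\ det3 structX * ((1 + h 1%N 2%N) * o0 structX - t 0 * (h 1%N 2%N - 1) * o0 structM)
        = - (2 * lambda) * o0 (adj3 structX),
      det3 structX * ((1 + h 2%N 0%N) * o1 structX - t 1 * (h 2%N 0%N - 1) * o1 structM)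
        = - (2 * lambda) * o1 (adj3 structX),
      det3 structX * ((1 + h 0%N 1%N) * o2 structX - t 2 * (h 0%N 1%N - 1) * o2 structM)
        = - (2 * lambda) * o2 (adj3 structX) &
      3 * (2 * lambda) <= scal3 structM].
Proof.
move=> [N NE ein] h.
apply: (@einstein_rescaled _ structX structM (k 0) (k 1) (k 2) (t 0) (t 1) (t 2));
  rewrite ?sin_angle_neq0 ?sin_angle_sqr // => y z ly lz.
pose c a b d := q (bracket (adapted a) (adapted b)) (adapted d).
have -> : ricci_form4 (bracket_table (rescale structX (k 0) (k 1) (k 2)) structM
    (t 0 / k 0) (t 1 / k 1) (t 2 / k 2)) y z = ricci_form4 c y z.
  have sum6_eq F G : (forall a, (a < 6)%N -> F a = G a) -> sum6 F = sum6 G :> R.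
    by move=> FG; rewrite /sum6 !FG.
  rewrite /ricci_form4; apply: (sum6_eq) => a la; apply: (sum6_eq) => d ld.
  by rewrite /christoffel2 /c !bracket_adapted.
have br_l := bracket_linl; have br_r := bracket_linr.
rewrite -(@ricci_frame _ _ bracket q q_lin q_sym br_l br_r N NE adapted adapted_complete).
rewrite (ein (fun i : 'I_6 => adapted i)).
  by rewrite adapted_orthonormal //; ring.
by move=> i j; rewrite adapted_orthonormal.
Qed.

End PrincipalFrame.
End Core.

(** * Einstein inner products are invariant under half turns *)

Section HalfTurnInvariance.
Variable R : rcfType.
Local Notation W := ('rV[R]_3 * 'rV[R]_3)%type.

Definition half_turn (x a : 'rV[R]_3) := (2 * dot a x / dot x x) *: x - a.

(** If u is orthogonal to v and w, the half turn about u fixes u and changes the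
    sign of the plane spanned by v and w, whatever the angle between v and w. *)
Lemma half_turn_frame (u v w : 'rV[R]_3) a b c : dot u u != 0 -> dot u v = 0 -> dot u w = 0 ->
  half_turn u (a *: u + b *: v + c *: w) = a *: u + - b *: v + - c *: w.
Proof.
move=> uu uv uw; rewrite /half_turn.
have -> : dot (a *: u + b *: v + c *: w) u = a * dot u u + b * dot u v + c * dot u w.
  by rewrite /dot !mxE; ring.
rewrite uv uw !mulr0 !addr0 mulrA mulfK // mulr_natl mulr2n scalerDl.
by rewrite !opprD !addrA addrK !scaleNr.
Qed.

(** Once the principal bases are orthogonal, the half turns about uhat_0 and
    vhat_0 multiply each vector of the adapted frame by a sign, because the
    signs on uhat_i and vhat_i agree. *)
Lemma einstein_half_turn (q : W -> W -> R) lambda : inner q -> einstein_inner q lambda ->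
  exists x y : 'rV[R]_3, [/\ x != 0, y != 0 & forall A B,
    q (half_turn x A.1, half_turn y A.2) (half_turn x B.1, half_turn y B.2) = q A B].
Proof.
move=> qi qe; have [u [v [t P]]] := principal_bases (inner_lin qi) (inner_sym qi) (inner_pos qi).
have [x0 x1 x2 sM] := frame_equations qi P qe.
have [y0 y1 y2 sX] :=
  frame_equations (inner_swap qi) (principal_swap qi P) (einstein_swap qe).
have dX := triple_uhat qi P; have dM := triple_vhat qi P.
have sin_inv_ge1 n : (n < 3)%N -> 1 <= sin_angle t n ^- 2.
  move=> ln; rewrite (sin_angle_sqr qi P ln) invf_ge1 ?(sin_sqr_gt0 qi P ln) //.
  by rewrite gerBl sqr_ge0.
have t_le1 n : (n < 3)%N -> `|t n| <= 1.
  move=> ln; rewrite -(@expr_le1 _ 2) ?normr_ge0 // real_normK ?num_real //.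
  by have := sin_sqr_gt0 qi P ln; rewrite subr_gt0 => /ltW.
have h_ge1 m n : (m < 3)%N -> (n < 3)%N -> 1 <= (sin_angle t m ^- 2 + sin_angle t n ^- 2) / 2.
  move=> lm ln; have := sin_inv_ge1 _ lm; have := sin_inv_ge1 _ ln; lra.
have adjX := structure_adj dX; have adjM := structure_adj dM.
have DX : det3 (structX u t) != 0 by rewrite structure_det.
have DM : det3 (structM v t) != 0 by rewrite structure_det.
have pX w : 0 <= quad3 (adj3 (structX u t)) w by rewrite adjX gram_psd.
have pM w : 0 <= quad3 (adj3 (structM v t)) w by rewrite adjM gram_psd.
have [[X0 X1 X2] [M0 M1 M2]] := offdiag_eq0 DX DM pX pM sX sM
  (h_ge1 1%N 2%N isT isT) (h_ge1 2%N 0%N isT isT) (h_ge1 0%N 1%N isT isT)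
  (t_le1 0%N isT) (t_le1 1%N isT) (t_le1 2%N isT) x0 x1 x2 y0 y1 y2.
have orth (A : sym3 R) (a b c : 'rV[R]_3) : adj3 A = gram3 a b c ->
    o0 A = 0 -> o1 A = 0 -> o2 A = 0 -> dot a b = 0 /\ dot a c = 0.
  by move=> [_ _ _ _ h1 h2] A0 A1 A2; rewrite [dot a c]dotC -h1 -h2 A0 A1 A2 !mul0r subr0.
have [u01 u02] := orth _ _ _ _ adjX X0 X1 X2.
have [v01 v02] := orth _ _ _ _ adjM M0 M1 M2.
have neq0 (a b c : 'rV[R]_3) : triple a b c != 0 -> a != 0.
  by apply: contra_neq => ->; rewrite /triple /dot !mxE; ring.
have ux0 := neq0 _ _ _ dX; have vy0 := neq0 _ _ _ dM.
have dot_neq0 (a : 'rV[R]_3) : a != 0 -> dot a a != 0 by apply: contra_neq; exact: dot_eq0.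
exists (uhat u t 0), (vhat v t 0); split=> // A B.
pose rho (A : W) : W := (half_turn (uhat u t 0) A.1, half_turn (vhat v t 0) A.2).
pose e := adapted u v t; pose sgn d : R := if frame_index d == 0%N then 1 else -1.
have flip C d : (d < 6)%N -> q (rho C) (e d) = sgn d * q C (e d).
  move=> ld; have [x [y ->]] := comb_surj qi P C.
  pose s (z : nat -> R) n := if n is 0 then z n else - z n.
  have -> : rho (comb u v t x y) = comb u v t (s x) (s y).
    by rewrite /rho !combE /= !half_turn_frame ?dot_neq0.
  apply: etrans (comb_adapted qi P (s x) (s y) ld) _.
  rewrite (comb_adapted qi P x y ld) /sgn.
  by case: d ld => [|[|[|[|[|[|//]]]]]] _ /=; ring.
have parseval C D : q C D = \sum_(d < 6) q C (e d) * q D (e d).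
  rewrite {1}(adapted_complete qi P D) (inner_sym qi).
  rewrite (@linear_form_sum _ _ _ (fun w => q w C)); last by move=> *; rewrite (inner_lin qi).
  by apply: eq_bigr => d _; rewrite mulrC; congr (_ * _); exact: (inner_sym qi).
rewrite -/(rho A) -/(rho B) !parseval; apply: eq_bigr => d _; rewrite !flip //.
by rewrite /sgn; case: ifP; rewrite ?mul1r ?mulN1r ?mulrNN.
Qed.
End HalfTurnInvariance.

(** * Quaternions and SU(2) *)

Section Quaternion.
Local Open Scope complex_scope.
Variable R : realType.
Implicit Types (p : R) (a b : 'rV[R]_3).

(** The quaternion with real part p and imaginary part a, as a complex matrix. *)
Definition quat p a : 'M[R[i]]_2 := \matrix_(i < 2, j < 2)
  if i == 0 then if j == 0 then p +i* a 0 i0 else a 0 i1 +i* a 0 i2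
  else if j == 0 then (- a 0 i1) +i* a 0 i2 else p +i* (- a 0 i0).

Lemma ord2P (i : 'I_2) : {i = 0} + {i = 1}.
Proof. by case: i => -[|[|//]] h; [left|right]; apply: val_inj. Qed.

Lemma mat2P (T : Type) (A B : 'M[T]_2) : A 0 0 = B 0 0 -> A 0 1 = B 0 1 ->
  A 1 0 = B 1 0 -> A 1 1 = B 1 1 -> A = B.
Proof.
by move=> *; apply/matrixP => i j; case: (ord2P i) => ->; case: (ord2P j) => ->.
Qed.

Lemma mul2E (K : pzRingType) m n (A : 'M[K]_(m, 2)) (B : 'M[K]_(2, n)) i j :
  (A *m B) i j = A i 0 * B 0 j + A i 1 * B 1 j.
Proof.
rewrite mxE !big_ord_recl big_ord0 addr0.
by congr (_ + A i _ * B _ j); apply: val_inj.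
Qed.

Lemma quatM p a p' a' : quat p a *m quat p' a' =
  quat (p * p' - dot a a') (p *: a' + p' *: a + cross a a').
Proof.
by apply: mat2P; rewrite mul2E !mxE /=; apply/eqP; rewrite eq_complex /= /dot;
  apply/andP; split; apply/eqP; ring.
Qed.

Lemma quat1 : quat 1 0 = 1%:M.
Proof.
by apply: mat2P; rewrite !mxE /=; apply/eqP; rewrite eq_complex /= ?oppr0 !eqxx.
Qed.

Lemma quat_inj p a p' a' : quat p a = quat p' a' -> p = p' /\ a = a'.
Proof.
move=> /matrixP e; have := e 0 0; have := e 0 1; rewrite !mxE /= => -[e1 e2] [e0 e3].
by split=> //; apply: row3P.
Qed.

Lemma quatV p a : p ^+ 2 + dot a a = 1 -> quat p a *m quat p (- a) = 1%:M.
Proof.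
move=> n; rewrite quatM -quat1; congr quat.
  by rewrite -n /dot !mxE; ring.
by apply: row3P; rewrite /cross !mxE /=; ring.
Qed.

Lemma det2E (K : comNzRingType) (A : 'M[K]_2) : \det A = A 0 0 * A 1 1 - A 0 1 * A 1 0.
Proof.
rewrite (expand_det_row _ 0) !big_ord_recl big_ord0 addr0 /cofactor !det_mx11 !mxE /=.
rewrite expr0 expr1 mul1r mulN1r mulrN.
by congr (A _ _ * A _ _ - A _ _ * A _ _); apply: val_inj.
Qed.

Lemma quat_SU2 p a : p ^+ 2 + dot a a = 1 -> (quat p a \is unitarymx) && (\det (quat p a) == 1).
Proof.
move=> n; apply/andP; split; last first.
  rewrite det2E !mxE /= eq_complex /= -n /dot.
  by apply/andP; split; apply/eqP; ring.
apply/unitarymxP; rewrite -(quatV n); congr (_ *m _).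
by apply: mat2P; rewrite !mxE /=; apply/eqP; rewrite eq_complex /= ?opprK !eqxx.
Qed.

(** For determinant one the inverse is the classical adjoint; equating it with
    the conjugate transpose gives the shape of a quaternion. *)
Lemma SU2_quat (x : SU2 R) : exists p a, SU2val x = quat p a /\ p ^+ 2 + dot a a = 1.
Proof.
case: x => x /= /andP[/unitarymxP xU /eqP xd].
(* The classical adjoint of x. *)
pose y : 'M[R[i]]_2 := \matrix_(i < 2, j < 2)
  if i == 0 then if j == 0 then x 1 1 else - x 0 1 else if j == 0 then - x 1 0 else x 0 0.
have xy : x *m y = 1%:M.
  by apply: mat2P; rewrite mul2E !mxE /= -?xd ?det2E; ring.
have /matrixP e : y = map_mx Num.conj x^T.
  by rewrite -[LHS]mulmx1 -xU mulmxA (mulmx1C xy) mul1mx.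
have := e 0 0; have := e 1 0; rewrite !mxE /=.
case E0 : (x 0 0) => [p q]; case E1 : (x 0 1) => [r s]; case E2 : (x 1 0) => [r' s'].
case E3 : (x 1 1) => [p' q'] [e1 e2] [e3 e4]; exists p, (vec3 q r s); split.
  apply: mat2P; rewrite !mxE /= ?E0 ?E1 ?E2 ?E3; apply/eqP; rewrite eq_complex /=;
    apply/andP; split; apply/eqP; lra.
have := xd; rewrite det2E E0 E1 E2 E3 => /eqP; rewrite eq_complex /= => /andP[/eqP + _].
rewrite /dot !vec3E => <-; have -> : p' = p by lra.
have -> : q' = - q by lra. have -> : r' = - r by lra. have -> : s' = s by lra.
ring.
Qed.

End Quaternion.

(** * Velocities of curves of matrices *)

Section Velocity.
Local Open Scope complex_scope.
Variable R : realType.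
Local Notation G := (SU2 R * SU2 R)%type.
Local Notation M2 := 'M[R[i]]_2.
Local Notation V := (M2 * M2)%type.
Local Notation der := (is_derive (0 : R) (1 : R)).

Lemma der_eq (f : R -> R) x y : der f x -> x = y -> der f y.
Proof. by move=> ? <-. Qed.
Lemma der_unique (f : R -> R) x y : der f x -> der f y -> x = y.
Proof. by move=> fx fy; rewrite -(@derive_val _ _ _ _ _ _ _ fx) (@derive_val _ _ _ _ _ _ _ fy). Qed.
Lemma derD (f g : R -> R) x y : der f x -> der g y -> der (fun t => f t + g t) (x + y).
Proof. by move=> fx gy; exact: is_deriveD. Qed.
Lemma derN (f : R -> R) x : der f x -> der (fun t => - f t) (- x).
Proof. by move=> fx; exact: is_deriveN. Qed.
Lemma derM (f g : R -> R) x y : der f x -> der g y ->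
  der (fun t => f t * g t) (f 0 * y + g 0 * x).
Proof. by move=> fx gy; exact: is_deriveM. Qed.
Lemma derC (c : R) : der (fun _ => c) 0.
Proof. exact: is_derive_cst. Qed.
Lemma derZ (c : R) (f : R -> R) x : der f x -> der (fun t => c * f t) (c * x).
Proof. by move=> fx; apply: der_eq (derM (derC c) fx) _; rewrite mulr0 addr0. Qed.
Lemma der_id : der (fun t => t) 1.
Proof. exact: is_derive_id. Qed.
Lemma derV (f : R -> R) x : f 0 != 0 -> der f x -> der (fun t => (f t)^-1) (- (f 0) ^- 2 * x).
Proof. by move=> f0 fx; exact: is_deriveV. Qed.

Definition has_mvel (m : R -> M2) (w : M2) := forall i j,
  der (fun t => complex.Re (m t i j)) (complex.Re (w i j)) /\
  der (fun t => complex.Im (m t i j)) (complex.Im (w i j)).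
Definition has_vel (c : R -> V) (u : V) :=
  forall k, der (fun t => rcoord k (c t)) (rcoord k u).

Lemma has_velP c u : has_vel c u <->
  has_mvel (fun t => (c t).1) u.1 /\ has_mvel (fun t => (c t).2) u.2.
Proof.
split=> [h|[h1 h2] [[[[] []] i] j]]; last first.
- exact: (h2 i j).2.
- exact: (h2 i j).1.
- exact: (h1 i j).2.
- exact: (h1 i j).1.
split=> i j; split.
- exact: (h (true, true, i, j)).
- exact: (h (true, false, i, j)).
- exact: (h (false, true, i, j)).
- exact: (h (false, false, i, j)).
Qed.

Lemma ReM (x y : R[i]) : complex.Re (x * y) =
  complex.Re x * complex.Re y - complex.Im x * complex.Im y.
Proof. by case: x; case: y. Qed.
Lemma ImM (x y : R[i]) : complex.Im (x * y) =
  complex.Re x * complex.Im y + complex.Im x * complex.Re y.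
Proof. by case: x; case: y. Qed.
Lemma ReD (x y : R[i]) : complex.Re (x + y) = complex.Re x + complex.Re y.
Proof. by case: x; case: y. Qed.
Lemma ImD (x y : R[i]) : complex.Im (x + y) = complex.Im x + complex.Im y.
Proof. by case: x; case: y. Qed.

Lemma mvel_ext m m' w : (forall t, m t = m' t) -> has_mvel m w -> has_mvel m' w.
Proof. by move=> e; rewrite (funext e). Qed.

Lemma mvel_mull (A : M2) m w : has_mvel m w -> has_mvel (fun t => A *m m t) (A *m w).
Proof.
move=> mw i j; split.
- rewrite mul2E ReD !ReM.
  rewrite [X in der X](_ : _ = fun t =>
    (complex.Re (A i 0) * complex.Re (m t 0 j) + - (complex.Im (A i 0) * complex.Im (m t 0 j)))
    + (complex.Re (A i 1) * complex.Re (m t 1 j) + - (complex.Im (A i 1) * complex.Im (m t 1 j)))).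
    by apply: derD; apply: derD; try (apply: derN); apply: derZ; apply mw.
  by apply/funext => t; rewrite mul2E ReD !ReM.
- rewrite mul2E ImD !ImM.
  rewrite [X in der X](_ : _ = fun t =>
    (complex.Re (A i 0) * complex.Im (m t 0 j) + complex.Im (A i 0) * complex.Re (m t 0 j))
    + (complex.Re (A i 1) * complex.Im (m t 1 j) + complex.Im (A i 1) * complex.Re (m t 1 j))).
    by apply: derD; apply: derD; apply: derZ; apply mw.
  by apply/funext => t; rewrite mul2E ImD !ImM.
Qed.

Lemma mvel_tr m w : has_mvel m w -> has_mvel (fun t => (m t)^T) w^T.
Proof.
move=> mw i j; have [h1 h2] := mw j i; split.
  by rewrite mxE; rewrite [X in der X](_ : _ = fun t => complex.Re (m t j i)) //;
    apply/funext => t; rewrite mxE.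
by rewrite mxE; rewrite [X in der X](_ : _ = fun t => complex.Im (m t j i)) //;
  apply/funext => t; rewrite mxE.
Qed.

Lemma mvel_mulr (A : M2) m w : has_mvel m w -> has_mvel (fun t => m t *m A) (w *m A).
Proof.
move=> mw; rewrite -[w *m A]trmxK trmx_mul.
apply: (@mvel_ext (fun t => (A^T *m (m t)^T)^T)); last exact/mvel_tr/mvel_mull/mvel_tr.
by move=> t; rewrite trmx_mul !trmxK.
Qed.

Lemma mvel_unique m w w' : has_mvel m w -> has_mvel m w' -> w = w'.
Proof.
move=> h h'; apply/matrixP => i j; apply/eqP; rewrite eq_complex.
have [h1 h2] := h i j; have [h1' h2'] := h' i j.
by rewrite (der_unique h1 h1') (der_unique h2 h2') !eqxx.
Qed.

Lemma der_ext (f g : R -> R) x : f =1 g -> der f x -> der g x.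
Proof. by move=> /funext->. Qed.

Lemma mvel_quat (p : R -> R) (a : R -> 'rV[R]_3) (p' : R) (a' : 'rV[R]_3) : der p p' ->
  (forall k, der (fun t => a t 0 k) (a' 0 k)) ->
  has_mvel (fun t => quat (p t) (a t)) (quat p' a').
Proof.
move=> dp da i j; case: (ord2P i) => ->; case: (ord2P j) => ->; split.
- by rewrite mxE; apply: der_ext dp => t; rewrite mxE.
- by rewrite mxE; apply: der_ext (da i0) => t; rewrite mxE.
- by rewrite mxE; apply: der_ext (da i1) => t; rewrite mxE.
- by rewrite mxE; apply: der_ext (da i2) => t; rewrite mxE.
- by rewrite mxE; apply: der_ext (derN (da i1)) => t; rewrite mxE.
- by rewrite mxE; apply: der_ext (da i2) => t; rewrite mxE.
- by rewrite mxE; apply: der_ext dp => t; rewrite mxE.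
- by rewrite mxE; apply: der_ext (derN (da i0)) => t; rewrite mxE.
Qed.

(** The coordinates of a quaternion are among the real and imaginary parts of
    its matrix, so they inherit derivatives. *)
Lemma mvel_quatV (p : R -> R) (a : R -> 'rV[R]_3) w :
  has_mvel (fun t => quat (p t) (a t)) w -> exists p' a',
  [/\ w = quat p' a', der p p' & forall k, der (fun t => a t 0 k) (a' 0 k)].
Proof.
move=> h; have [h0 h1] := h 0 0; have [h2 h3] := h 0 1.
have dp : der p (complex.Re (w 0 0)) by apply: der_ext h0 => t; rewrite mxE.
have da k : der (fun t => a t 0 k)
    (vec3 (complex.Im (w 0 0)) (complex.Re (w 0 1)) (complex.Im (w 0 1)) 0 k).
  case: k => -[|[|[|//]]] lt3; rewrite mxE /=.
  - by apply: der_ext h1 => t; rewrite mxE /=; congr (a t 0 _); apply: val_inj.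
  - by apply: der_ext h2 => t; rewrite mxE /=; congr (a t 0 _); apply: val_inj.
  - by apply: der_ext h3 => t; rewrite mxE /=; congr (a t 0 _); apply: val_inj.
by do 2 eexists; split; [exact: mvel_unique h (mvel_quat dp da) | exact: dp | exact: da].
Qed.

(** The factor 1/2 makes the commutator of matrices equal to the cross
    product. *)
Definition su2 (a : 'rV[R]_3) : M2 := quat 0 (2^-1 *: a).

Lemma su2_bracket a b : su2 a *m su2 b - su2 b *m su2 a = su2 (cross a b).
Proof.
have quatB p x p' y : quat p x - quat p' y = quat (p - p') (x - y).
  by apply: mat2P; rewrite !mxE /=; apply/eqP; rewrite eq_complex /=;
    apply/andP; split; apply/eqP; ring.
have half : 2^-1 = 2 * (2^-1 * 2^-1) :> R by field.
rewrite /su2 !quatM quatB [in RHS]half; generalize (2^-1 : R) => c.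
by congr quat; [rewrite /dot !mxE | apply: row3P; rewrite /cross !mxE /=]; ring.
Qed.

Lemma su2_lin c a b : su2 (c *: a + b) = c%:C *: su2 a + su2 b.
Proof.
apply: mat2P; rewrite !mxE /=; apply/eqP; rewrite eq_complex /=;
  apply/andP; split; apply/eqP; rewrite ?mxE; ring.
Qed.

Lemma su2_inj a b : su2 a = su2 b -> a = b.
Proof.
case/quat_inj => _ /(congr1 (fun x => 2 *: x)).
by rewrite !scalerA divff ?scale1r // pnatr_eq0.
Qed.

(** The rational parametrisation of the circle,
    ((1 - n t^2) + 2 t b) / (1 + n t^2) with n = |b|^2, avoids the exponential. *)
Lemma SU2_curve (a : 'rV[R]_3) : exists2 gam : R -> SU2 R,
  gam 0 = SU2_one R & has_mvel (fun t => SU2val (gam t)) (su2 a).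
Proof.
(* The curve has velocity 2 b, and su2 a is the quaternion a / 2. *)
pose b := 4^-1 *: a; pose n := dot b b.
have n_ge0 : 0 <= n by exact: dot_ge0.
pose s t := 1 + n * (t * t).
have s_gt0 t : 0 < s t by rewrite ltr_wpDr // mulr_ge0 // -expr2 sqr_ge0.
pose p t := (1 - n * (t * t)) * (s t)^-1.
pose v t := (2 * t * (s t)^-1) *: b.
have unit t : p t ^+ 2 + dot (v t) (v t) = 1.
  have -> : dot (v t) (v t) = (2 * t * (s t)^-1) ^+ 2 * n by rewrite /n /dot !mxE; ring.
  by rewrite /p /s; field; rewrite -[_ != 0]/(s t != 0) gt_eqF.
exists (fun t => MkSU2 (quat_SU2 (unit t))).
  apply: val_inj; rewrite /= -quat1 /p /v /s; congr quat.
    by rewrite !mul0r mulr0 subr0 addr0 invr1 mulr1.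
  by rewrite mulr0 mul0r scale0r.
have s0 : s 0 = 1 by rewrite /s mulr0 mulr0 addr0.
have ds : der s 0.
  apply: der_eq (derD (derC 1) (derZ n (derM der_id der_id))) _.
  by ring.
have dsV : der (fun t => (s t)^-1) 0.
  by apply: der_eq (derV _ ds) _; rewrite ?s0 ?oner_eq0 // mulr0.
rewrite /su2; apply: mvel_quat.
  apply: der_eq (derM (derD (derC 1) (derN (derZ n (derM der_id der_id)))) dsV) _.
  by ring.
move=> k; have -> : (2^-1 *: a) 0 k = b 0 k * (2 * 1).
  by rewrite !mxE; field.
apply: (@der_ext (fun t => b 0 k * (2 * t * (s t)^-1))).
  by move=> t; rewrite !mxE mulrC.
apply: der_eq (derZ (b 0 k) (derM (derZ 2 der_id) dsV)) _.
by rewrite s0; field.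
Qed.

End Velocity.

(** * Left-invariant calculus on SU(2) x SU(2) *)

Section Tangent.
Local Open Scope complex_scope.
Variable R : realType.
Local Notation G := (SU2 R * SU2 R)%type.
Local Notation M2 := 'M[R[i]]_2.
Local Notation V := (M2 * M2)%type.
Local Notation W := ('rV[R]_3 * 'rV[R]_3)%type.
Local Notation der := (is_derive (0 : R) (1 : R)).

Definition lieW (w : W) : V := (su2 w.1, su2 w.2).

Lemma lieW_lin a w w' : lieW (a *: w + w') = a%:C *: lieW w + lieW w'.
Proof. by rewrite /lieW /= !su2_lin. Qed.

Lemma lieW0 : lieW 0 = 0.
Proof. by have := lieW_lin (-1) 0 0; rewrite scaler0 addr0 rmorphN1 scaleN1r addNr. Qed.

Lemma lieW_inj : injective lieW.
Proof. by move=> [a b] [a' b'] [/su2_inj-> /su2_inj->]. Qed.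

Lemma lieW_bracket A B : lieW (bracket A B) = ((lieW A).1 *m (lieW B).1 - (lieW B).1 *m (lieW A).1,
                               (lieW A).2 *m (lieW B).2 - (lieW B).2 *m (lieW A).2).
Proof. by rewrite /lieW /bracket /= !su2_bracket. Qed.

Lemma embedM (x y : G) :
  embed (x * y)%g = (SU2val x.1 *m SU2val y.1, SU2val x.2 *m SU2val y.2).
Proof. by []. Qed.

(** Differentiating p^2 + |a|^2 = 1 at p = 1, a = 0 shows that the real part
    of the velocity vanishes. *)
Lemma SU2_velocity1 (gam : R -> SU2 R) w : gam 0 = SU2_one R ->
  has_mvel (fun t => SU2val (gam t)) w -> exists a, w = su2 a.
Proof.
move=> gam0 gw.
have /choice[pa paE] t : exists pa : R * 'rV[R]_3,
    SU2val (gam t) = quat pa.1 pa.2 /\ pa.1 ^+ 2 + dot pa.2 pa.2 = 1.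
  by have [p [a]] := SU2_quat (gam t); exists (p, a).
pose p t := (pa t).1; pose a t := (pa t).2.
have [p' [a' [-> dp da]]] : exists p' a',
    [/\ w = quat p' a', der p p' & forall k, der (fun t => a t 0 k) (a' 0 k)].
  by apply: mvel_quatV; apply: mvel_ext gw => t; have [] := paE t.
have [p0 a0] : p 0 = 1 /\ a 0 = 0.
  by apply: quat_inj; rewrite quat1 -(paE 0).1 gam0.
have dsq (f : R -> R) y : der f y -> der (fun t => f t * f t) (f 0 * y + f 0 * y).
  by move=> fy; exact: derM.
have : der (fun t => p t * p t + (a t 0 i0 * a t 0 i0 + a t 0 i1 * a t 0 i1
    + a t 0 i2 * a t 0 i2)) (2 * p').
  apply: der_eq (derD (dsq _ _ dp) (derD (derD (dsq _ _ (da i0)) (dsq _ _ (da i1)))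
    (dsq _ _ (da i2)))) _.
  by rewrite p0 a0 !mxE; ring.
have -> : (fun t => p t * p t + (a t 0 i0 * a t 0 i0 + a t 0 i1 * a t 0 i1
    + a t 0 i2 * a t 0 i2)) = (fun=> 1).
  by apply/funext => t; rewrite -expr2 -/(dot (a t) (a t)) (paE t).2.
move=> /(der_unique (derC 1)) => p'0; exists (2 *: a').
rewrite /su2 scalerA mulVf ?pnatr_eq0 // scale1r; congr quat.
by apply: (@mulfI _ 2) => //; rewrite mulr0 -p'0.
Qed.

Lemma tangent_curve w : exists2 gam : R -> G, gam 0 = 1%g & velocity gam (lieW w).
Proof.
have [g1 g10 v1] := SU2_curve w.1; have [g2 g20 v2] := SU2_curve w.2.
exists (fun t => (g1 t, g2 t)); first by rewrite g10 g20.
by apply/(has_velP (fun t => embed (g1 t, g2 t))).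
Qed.

Lemma left_velocity (a : G) (gam : R -> G) u : velocity gam u ->
  velocity (fun t => a * gam t)%g (left_field u a).
Proof.
move=> /(has_velP (fun t => embed (gam t)))[v1 v2].
by apply/(has_velP (fun t => embed (a * gam t)%g)); split; exact: mvel_mull.
Qed.

Lemma left_fieldM (a x : G) u :
  left_field (left_field u x) a = left_field u (a * x)%g.
Proof. by rewrite /left_field /= !mulmxA. Qed.

Lemma left_field1 u : left_field u (1%g : G) = u.
Proof. by case: u => u1 u2; rewrite /left_field /= !mul1mx. Qed.

(** Left translation to the identity reduces to [SU2_velocity1]. *)
Lemma tangentP (x : G) u : tangent x u <-> exists w, u = left_field (lieW w) x.
Proof.
split=> [[gam gx gu]|[w ->]]; last first.
  have [gam g1 gv] := tangent_curve w; exists (fun t => x * gam t)%g.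
    by rewrite g1 mulg1.
  exact: left_velocity.
have := left_velocity x^-1%g gu => /(has_velP (fun t => embed (x^-1 * gam t)%g))[v1 v2].
have g1 : (x^-1 * gam 0 = 1)%g by rewrite gx mulVg.
have [a ua] := SU2_velocity1 (gam := fun t => (x^-1 * gam t)%g.1) (congr1 fst g1) v1.
have [b ub] := SU2_velocity1 (gam := fun t => (x^-1 * gam t)%g.2) (congr1 snd g1) v2.
exists (a, b); rewrite -[LHS]left_field1 -(mulgV x) -left_fieldM; congr left_field.
by rewrite /lieW /= -ua -ub.
Qed.

Lemma tangent_left x w : tangent x (left_field (lieW w) x).
Proof. by apply/tangentP; exists w. Qed.

Lemma dirderivE f (x : G) u w : tangent x u -> is_dirderiv f x u w -> dirderiv f x u = w.
Proof.
move=> [gam gx gu] fw; rewrite /dirderiv; case: xgetP => [y _ fy|/(_ w)//].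
by exact: der_unique (fy _ gx gu) (fw _ gx gu).
Qed.

(** Differentiability along curves is bundled with linearity because velocities
    are defined coordinatewise. *)
Definition functional (l : V -> R) :=
  (forall (a : R) u v, l (a%:C *: u + v) = a * l u + l v) /\
  (forall c u, has_vel c u -> der (l \o c) (l u)).

Lemma functional_rcoord k : functional (rcoord k).
Proof.
split=> [a u v|c u]; last by apply.
have ReZ (z : R[i]) : complex.Re (a%:C * z) = a * complex.Re z.
  by case: z => x y /=; rewrite mul0r subr0.
have ImZ (z : R[i]) : complex.Im (a%:C * z) = a * complex.Im z.
  by case: z => x y /=; rewrite mul0r addr0.
by case: k => [[[[] []] i] j]; rewrite /= !mxE ?(ReD, ImD) ?(ReZ, ImZ).
Qed.

(** Left translations, conjugations and left-invariant fields are all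
    restrictions of such maps, so their calculus is that of linear maps. *)
Definition two_sided (A B : V) (u : V) : V := (A.1 *m u.1 *m B.1, A.2 *m u.2 *m B.2).

Lemma vel_two_sided A B c u : has_vel c u -> has_vel (two_sided A B \o c) (two_sided A B u).
Proof.
by move=> /has_velP[v1 v2]; apply/has_velP; split; apply: mvel_mulr; exact: mvel_mull.
Qed.

Lemma functional_two_sided A B l : functional l -> functional (l \o two_sided A B).
Proof.
move=> [l1 l2]; split=> [a u v|c u cu]; last exact: (l2 _ _ (vel_two_sided A B cu)).
rewrite /= -l1; congr l; congr pair;
  by rewrite /= mulmxDr mulmxDl -scalemxAr -scalemxAl.
Qed.

Definition affine (f : G -> R) :=
  exists l c, functional l /\ f = fun x => l (embed x) + c.

Lemma affine_is_dirderiv l c x u : functional l ->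
  is_dirderiv (fun x => l (embed x) + c) x u (l u).
Proof.
move=> [_ ld] gam gx gu; apply: der_eq (derD (ld _ _ gu) (derC c)) _.
exact: addr0.
Qed.

Lemma affine_dirderiv l c x u : functional l -> tangent x u ->
  dirderiv (fun x => l (embed x) + c) x u = l u.
Proof. by move=> fl xu; apply: dirderivE => //; exact: affine_is_dirderiv. Qed.

Lemma left_field_two_sided A (x : G) : left_field A x = two_sided (1%:M, 1%:M) A (embed x).
Proof. by rewrite /left_field /two_sided /= !mul1mx. Qed.

(** Restrictions of affine functions form a family stable under differentiation
    along left-invariant fields, since x |-> x A is linear. *)
Lemma smooth_affine f : affine f -> smooth f.
Proof.
move=> af; exists affine; split=> // {f af} _ [l [c [fl ->]]]; split=> [x|A TA].
  exists l; first by case: fl.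
  by move=> u _; exact: affine_is_dirderiv.
exists (l \o two_sided (1%:M, 1%:M) A), 0; split; first exact: functional_two_sided.
apply/funext => x; rewrite addr0 /= -left_field_two_sided affine_dirderiv //.
by have /tangentP[w ->] := TA; rewrite left_field1; exact: tangent_left.
Qed.

Lemma smooth_two_sided k A B : smooth (fun x : G => rcoord k (two_sided A B (embed x))).
Proof.
apply: smooth_affine; exists (rcoord k \o two_sided A B), 0.
split; first exact/functional_two_sided/functional_rcoord.
by apply/funext => x; rewrite addr0.
Qed.

Lemma dirderiv_two_sided k A B (x : G) u : tangent x u ->
  dirderiv (fun x => rcoord k (two_sided A B (embed x))) x u = rcoord k (two_sided A B u).
Proof.
move=> xu; rewrite -[RHS]/((rcoord k \o two_sided A B) u).
rewrite -(@affine_dirderiv (rcoord k \o two_sided A B) 0 x) //.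
  by congr dirderiv; apply/funext => y; rewrite addr0.
exact/functional_two_sided/functional_rcoord.
Qed.

Lemma of_rcoordK (u : V) : of_rcoord (fun k => rcoord k u) = u.
Proof.
by case: u => u1 u2; congr pair; apply/matrixP => i j; rewrite !mxE /=; case: (_ i j).
Qed.

Lemma vector_field_left w : vector_field (fun x : G => left_field (lieW w) x).
Proof.
split=> [x|k]; first exact: tangent_left.
have := smooth_two_sided k (1%:M, 1%:M) (lieW w).
by congr smooth; apply/funext => x; rewrite -left_field_two_sided.
Qed.

(** The field x |-> x A has ambient derivative v |-> v A, so the bracket of
    two such fields is x |-> x (A B - B A). *)
Lemma lie_bracket_left w w' :
  lie_bracket (left_field (lieW w)) (left_field (lieW w')) =
    left_field (lieW (bracket w w')) :> (G -> V).
Proof.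
apply/funext => x; rewrite /lie_bracket -[RHS]of_rcoordK; congr of_rcoord.
apply/funext => k; rewrite /along.
have E z z' : dirderiv (fun y : G => rcoord k (left_field (lieW z) y)) x (left_field (lieW z') x) =
    rcoord k (two_sided (1%:M, 1%:M) (lieW z) (left_field (lieW z') x)).
  have fE : (fun y : G => rcoord k (left_field (lieW z) y)) =
      fun y => rcoord k (two_sided (1%:M, 1%:M) (lieW z) (embed y)).
    by apply/funext => y; rewrite -left_field_two_sided.
  by rewrite fE dirderiv_two_sided //; exact: tangent_left.
rewrite !E; have [kl _] := functional_rcoord k.
have -> (a b : R) : a - b = (-1) * b + a by rewrite mulN1r addrC.
rewrite -kl; congr rcoord.
rewrite rmorphN1 scaleN1r addrC /two_sided /left_field lieW_bracket.
by congr pair; rewrite /= !mul1mx mulmxBr !mulmxA.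
Qed.

Lemma differential_two_sided (phi : G -> G) A B x u :
  (forall y, embed (phi y) = two_sided A B (embed y)) -> tangent x u ->
  differential phi x u = two_sided A B u.
Proof.
move=> phiE xu; rewrite -[RHS]of_rcoordK; congr of_rcoord; apply/funext => k.
by rewrite -(dirderiv_two_sided k A B xu); congr dirderiv; apply/funext => y; rewrite phiE.
Qed.

End Tangent.

(** * From the Einstein equation to the Lie algebra, and back to an isometry *)

Section LeftInvariant.
Local Open Scope complex_scope.
Variable R : realType.
Local Notation G := (SU2 R * SU2 R)%type.
Local Notation M2 := 'M[R[i]]_2.
Local Notation V := (M2 * M2)%type.
Local Notation W := ('rV[R]_3 * 'rV[R]_3)%type.
Variable g : metric R.
Hypotheses (g_riem : riemannian g) (g_inv : left_invariant g).
Local Notation L A := (fun x : G => left_field (lieW A) x).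

Definition metric1 (A B : W) := g 1%g (lieW A) (lieW B).
Local Notation q := metric1.

(** Left translation by x is an isometry that carries left-invariant fields to
    themselves, so products of such fields are constant. *)
Lemma metric_left x A B : g x (left_field (lieW A) x) (left_field (lieW B) x) = q A B.
Proof.
have [_ [_ _ _ _ H]] := g_inv x.
have T A' : tangent (1%g : G) (lieW A') by rewrite -[lieW A']left_field1; exact: tangent_left.
have := H _ _ _ (T A) (T B); rewrite mulg1.
have E A' : differential (fun y => x * y)%g 1%g (lieW A') = left_field (lieW A') x.
  rewrite (@differential_two_sided _ _ (embed x) (1%:M, 1%:M)) //.
    by rewrite /two_sided /= !mulmx1.
  by move=> y; rewrite embedM /two_sided /= !mulmx1.
by rewrite !E.
Qed.

Lemma tangent1J A : tangent (1%g : G) (lieW A).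
Proof. by rewrite -[lieW A]left_field1; exact: tangent_left. Qed.

Lemma inner_metric1 : inner q.
Proof.
have [sy li po _] := g_riem; split=> [a u v w|u v|u u0].
- by rewrite /metric1 lieW_lin li //; exact: tangent1J.
- by apply: sy; exact: tangent1J.
- apply: po; first exact: tangent1J.
  by apply: contra_neq u0; rewrite -lieW0; exact: lieW_inj.
Qed.

Lemma dirderiv_cst c (x : G) u : tangent x u -> dirderiv (fun=> c) x u = 0.
Proof. by move=> xu; apply: dirderivE => // gam _ _; exact: derC. Qed.

Lemma metricB x u v w : tangent x u -> tangent x v -> tangent x w ->
  g x (u - v) w = g x u w - g x v w.
Proof.
have [_ li _ _] := g_riem => xu xv xw.
have -> : u - v = (-1)%:C *: v + u by rewrite rmorphN1 scaleN1r addrC.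
by rewrite li // mulN1r addrC.
Qed.

Section Connection.
Variable nabla : (G -> V) -> (G -> V) -> (G -> V).
Hypothesis nablaP : levi_civita g nabla.

(** The metric is constant on left-invariant fields; the vanishing of the three
    corresponding derivatives, combined with the torsion identity, determines
    the connection. *)
Lemma koszul_formula x A B C :
  2 * g x (nabla (L A) (L B) x) (left_field (lieW C) x) = koszul (@bracket R) q A B C.
Proof.
have [sy li po _] := g_riem; have [vf _ _ tor compat] := nablaP.
have tan X Y : tangent x (nabla (L X) (L Y) x).
  by have [] := vf _ _ (vector_field_left X) (vector_field_left Y).
pose T X Y Z := g x (nabla (L X) (L Y) x) (left_field (lieW Z) x).
have anti X Y Z : T X Y Z + T X Z Y = 0.
  have /(congr1 (fun f => f x)) := compat _ _ _ (vector_field_left X) (vector_field_left Y)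
    (vector_field_left Z).
  rewrite /= /along (_ : (fun y => _) = fun=> q Y Z); last first.
    by apply/funext => y; exact: metric_left.
  rewrite dirderiv_cst; last exact: tangent_left.
  by rewrite [X in _ = _ + X]sy //; exact: tangent_left.
have torsion X Y Z : T X Y Z - T Y X Z = q (bracket X Y) Z.
  have /(congr1 (fun f => f x)) := tor _ _ (vector_field_left X) (vector_field_left Y).
  rewrite -(metric_left x) /T -metricB //; last exact: tangent_left.
  by move=> /= ->; rewrite (lie_bracket_left X Y).
rewrite -/(T A B C) /koszul.
have := anti A B C; have := anti B C A; have := anti C A B.
rewrite -!torsion; move: (T A B C) (T B A C) (T A C B) (T B C A) (T C A B) (T C B A).
by clear => *; lra.
Qed.

(** By [koszul_formula], the products of the derivative with left-invariant
    fields do not depend on the point, so it is itself left-invariant. *)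
Lemma nabla_left : exists N : W -> W -> W, forall A B, nabla (L A) (L B) = L (N A B).
Proof.
have [vf _ _ _ _] := nablaP.
have /choice[F FE] (AB : W * W) : exists w, nabla (L AB.1) (L AB.2) = L w.
  case: AB => A B /=.
  have ex x : exists w, nabla (L A) (L B) x = left_field (lieW w) x.
    by apply/tangentP; have [] := vf _ _ (vector_field_left A) (vector_field_left B).
  have [w w1] := ex 1%g; exists w; apply/funext => x; have [w' wx] := ex x.
  suff -> : w = w' by [].
  have qE C : 2 * q w C = 2 * q w' C.
    rewrite -(metric_left 1%g w C) -(metric_left x w' C) -w1 -wx !koszul_formula //.
  have qi := inner_metric1; apply/eqP/negPn/negP => /[1!eq_sym] ne.
  have : 0 < q (-1 *: w + w') (-1 *: w + w').
    by apply: inner_pos => //; rewrite scaleN1r addrC subr_eq0.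
  rewrite (inner_lin qi) mulN1r.
  have := qE (-1 *: w + w'); lra.
by exists (fun A B => F (A, B)) => A B; exact: (FE (A, B)).
Qed.
End Connection.

Lemma einstein_metric1 lambda : einstein g lambda -> einstein_inner q lambda.
Proof.
move=> [nabla nablaP ein]; have [N NE] := nabla_left nablaP; exists N.
  move=> A B C; rewrite -(koszul_formula nablaP 1%g).
  by rewrite NE metric_left.
move=> E orth Y Z.
have := ein 1%g (fun i => L (E i)) (L Y) (L Z) (fun i => vector_field_left (E i)).
rewrite metric_left => <- //; first last.
- exact: vector_field_left.
- exact: vector_field_left.
- by move=> i j; rewrite metric_left.
rewrite /ricci; apply: eq_bigr => a _.
rewrite /curvature !NE (lie_bracket_left (E a) Y) NE -(metric_left 1%g).
have lieWB u v : lieW (u - v) = lieW u - lieW v.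
  have -> : u - v = -1 *: v + u by rewrite scaleN1r addrC.
  by rewrite lieW_lin rmorphN1 scaleN1r addrC.
by congr g; rewrite !left_field1 !lieWB.
Qed.
End LeftInvariant.

Section HalfTurn.
Variable R : realType.
Local Notation G := (SU2 R * SU2 R)%type.

(** Conjugation by the unit imaginary quaternion in the direction of x is the
    half turn about x.  It is not central: otherwise its
    cross products with two coordinate vectors would vanish. *)
Lemma half_turn_SU2 (x : 'rV[R]_3) : x != 0 -> exists a : SU2 R,
  (forall b, SU2val a *m su2 b *m SU2val a^-1%g = su2 (half_turn x b)) /\
  (exists z : SU2 R, (a * z * a^-1)%g <> z).
Proof.
move=> x0; pose n := dot x x; have n_gt0 : 0 < n.
  by rewrite lt_def dot_ge0 andbT; apply: contra_neq x0; exact: dot_eq0.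
pose e := (Num.sqrt n)^-1 *: x.
have ss : (Num.sqrt n)^-1 * (Num.sqrt n)^-1 = n^-1.
  by rewrite -invfM -expr2 sqr_sqrtr // ltW.
have de b : dot e b = (Num.sqrt n)^-1 * dot x b by rewrite /dot !mxE; ring.
have ee : 0 ^+ 2 + dot e e = 1.
  by rewrite expr0n add0r de [dot x e]dotC de mulrA ss mulVf // gt_eqF.
pose a := MkSU2 (quat_SU2 ee).
have aV : SU2val a^-1%g = quat 0 (- e).
  have H : SU2val a *m quat 0 (- e) = 1%:M by exact: quatV ee.
  rewrite -[RHS]mul1mx -[1%:M](_ : SU2val a^-1%g *m SU2val a = 1%:M).
    by rewrite -mulmxA H mulmx1.
  by rewrite /= mulVmx // (SU2_unit a).
exists a; split=> [b|].
  rewrite aV /= /su2 !quatM; congr quat.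
    by rewrite /dot /cross !mxE /=; ring.
  have E : half_turn x b = (2 * dot b e) *: e - b.
    rewrite /half_turn; congr (_ - _); rewrite [dot b e]dotC de scalerA; congr (_ *: _).
    by rewrite -/n -ss dotC; ring.
  rewrite E; have := ee; rewrite /dot; generalize e => f ff.
  apply: row3P; rewrite !mxE /=; move: ff;
  move: (f 0 i0) (f 0 i1) (f 0 i2) (b 0 i0) (b 0 i1) (b 0 i2) => e0 e1 e2 b0 b1 b2 ff;
  apply/eqP; rewrite -subr_eq0; apply/eqP.
  - transitivity ((1 - (0 ^+ 2 + (e0 * e0 + e1 * e1 + e2 * e2))) * (2^-1 * b0));
      [by field | by rewrite ff subrr mul0r].
  - transitivity ((1 - (0 ^+ 2 + (e0 * e0 + e1 * e1 + e2 * e2))) * (2^-1 * b1));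
      [by field | by rewrite ff subrr mul0r].
  - transitivity ((1 - (0 ^+ 2 + (e0 * e0 + e1 * e1 + e2 * e2))) * (2^-1 * b2));
      [by field | by rewrite ff subrr mul0r].
apply: contrapT => /forallNP comm.
have ce0 f (ff : 0 ^+ 2 + dot f f = 1) : cross e f = 0.
  have /(congr1 (fun z => (z * a)%g)) := contrapT (comm (MkSU2 (quat_SU2 ff))).
  rewrite mulgVK => /(congr1 (@SU2val R)) /=; rewrite !quatM => /quat_inj[_].
  rewrite !scale0r !add0r => ef; apply: row3P; rewrite [RHS]mxE.
  - have := congr1 (fun z : 'rV_3 => z 0 i0) ef; rewrite /cross !mxE /=; lra.
  - have := congr1 (fun z : 'rV_3 => z 0 i1) ef; rewrite /cross !mxE /=; lra.
  - have := congr1 (fun z : 'rV_3 => z 0 i2) ef; rewrite /cross !mxE /=; lra.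
have f0 : 0 ^+ 2 + dot (vec3 1 0 0) (vec3 1 0 0) = 1 :> R by rewrite /dot !mxE /=; ring.
have f1 : 0 ^+ 2 + dot (vec3 0 1 0) (vec3 0 1 0) = 1 :> R by rewrite /dot !mxE /=; ring.
have c0 := ce0 _ f0; have c1 := ce0 _ f1.
have z0 : e 0 i0 = 0.
  by have := congr1 (fun z : 'rV_3 => z 0 i2) c1; rewrite /cross !mxE /=; lra.
have z1 : e 0 i1 = 0.
  by have := congr1 (fun z : 'rV_3 => z 0 i2) c0; rewrite /cross !mxE /=; lra.
have z2 : e 0 i2 = 0.
  by have := congr1 (fun z : 'rV_3 => z 0 i1) c0; rewrite /cross !mxE /=; lra.
by have /eqP := ee; rewrite /dot z0 z1 z2 expr0n !mulr0 !addr0 eq_sym oner_eq0.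
Qed.
End HalfTurn.

Section Isometry.
Variable R : realType.
Local Notation G := (SU2 R * SU2 R)%type.
Variable g : metric R.
Hypotheses (g_riem : riemannian g) (g_inv : left_invariant g).
Local Open Scope group_scope.

(** At x, the differential of conjugation by a carries the left-invariant
    field of A to that of Ad_a A, so only the adjoint action matters. *)
Lemma conj_isometry (a : G) (r : 'rV[R]_3 -> 'rV[R]_3) (s : 'rV[R]_3 -> 'rV[R]_3) :
  (forall b, SU2val a.1 *m su2 b *m SU2val a.1^-1 = su2 (r b)) ->
  (forall b, SU2val a.2 *m su2 b *m SU2val a.2^-1 = su2 (s b)) ->
  (forall A B, metric1 g (r A.1, s A.2) (r B.1, s B.2) = metric1 g A B) ->
  isometries g (fun x => a * x * a^-1).
Proof.
move=> ra sa ginv.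
have two b (y : G) : embed (b * y * b^-1) = two_sided (embed b) (embed b^-1) (embed y) by [].
have smooth_conj b : smooth_map (fun x : G => b * x * b^-1).
  by move=> k; exact: (smooth_two_sided k (embed b) (embed b^-1)).
exists (fun x => a^-1 * x * a); split.
- by move=> x; rewrite !mulgA mulVg mul1g mulgVK.
- by move=> x; rewrite !mulgA mulgV mul1g mulgK.
- exact: smooth_conj.
- have := smooth_conj a^-1; rewrite /smooth_map; move=> h k.
  by have := h k; rewrite invgK.
move=> x _ _ /tangentP[A ->] /tangentP[B ->].
have E A' : differential (fun y => a * y * a^-1) x (left_field (lieW A') x) =
    left_field (lieW (r A'.1, s A'.2)) (a * x * a^-1).
  rewrite (@differential_two_sided _ _ (embed a) (embed a^-1)) //; last exact: tangent_left.
  rewrite /two_sided /left_field /lieW /= -ra -sa.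
  by congr pair; rewrite !mulmxA [_ *m invmx _ *m _]mulmxKV // SU2_unit.
by rewrite !E !metric_left.
Qed.

End Isometry.

Theorem theorem1p1 (R : realType) (g : metric R)
    (g_riem : riemannian g) (g_inv : left_invariant g) :
  (exists lambda : R, einstein g lambda) -> inner_isotropy g <> [set id].
Proof.
move=> [lambda /(einstein_metric1 g_riem g_inv) ein] K1.
have [x [y [x0 y0 inv]]] := einstein_half_turn (inner_metric1 g_riem) ein.
have [a [aE [z az]]] := half_turn_SU2 x0; have [b [bE _]] := half_turn_SU2 y0.
have : inner_isotropy g (fun w => (a, b) * w * (a, b)^-1)%g.
  split; last by exists (a, b).
  exact: (conj_isometry g_inv (a := (a, b)) aE bE inv).
by rewrite K1 => /(congr1 (fun f : SU2 R * SU2 R -> SU2 R * SU2 R => (f (z, 1%g)).1)).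
Qed.
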